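(* There is a deterministic algorithm $\mathsf{SGN}$ which, on input an $n\times n$ complex matrix $A$ with $\|A\|\le 1$, a number $K$ with $K\ge \kappa_{\mathrm{sign}}(A)$, and a desired accuracy $\beta\in(0,1/12)$, outputs an approximation $\mathsf{SGN}(A)$ with $$\|\mathsf{SGN}(A)-\mathrm{sgn}(A)\|\le\beta,$$ in $$O\big((\log K+\log\log(1/\beta))\,T_{\mathsf{INV}}(n)\big)$$ arithmetic operations on a floating point machine with $$\lg(1/\mathbf{u})=O\big(\log n\,\log^3K\,(\log K+\log(1/\beta))\big)$$ bits of precision, where $T_{\mathsf{INV}}(n)$ denotes the number of arithmetic operations used by a numerically stable matrix inversion algorithm.
   Context: $\|\cdot\|$ is the spectral norm; $\lg$ is the logarithm base 2. Floating point model: with machine precision $\mathbf{u}>0$, every number $x\in\mathbb{C}$ is stored as $(1+\Delta)x$ for some adversarially chosen $|\Delta|\le\mathbf{u}$, and each operation $\circ\in\{+,-,\times,\div\}$ returns $(x\circ y)(1+\Delta)$ for some adversarially chosen $|\Delta|\le\mathbf{u}$; square roots of reals likewise are returned with relative error at most $\mathbf{u}$. The number of bits of precision is $\lg(1/\mathbf{u})$. Overflow and underflow are ignored. Stable inversion: a $(\mu_{\mathsf{INV}}(n),c_{\mathsf{INV}})$-stable inversion algorithm $\mathsf{INV}$ takes $A\in\mathbb{C}^{n\times n}$ and a precision $\mathbf{u}$ and outputs $C$ with $\|C-A^{-1}\|\le\mu_{\mathsf{INV}}(n)\cdot\mathbf{u}\cdot\kappa(A)^{c_{\mathsf{INV}}\log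 n}\|A^{-1}\|$, where $\kappa(A)=\|A\|\|A^{-1}\|$, on a floating point machine with precision $\mathbf{u}$ in $T_{\mathsf{INV}}(n)$ arithmetic operations. It is assumed that $\mu_{\mathsf{INV}}(n)\ge1$, $c_{\mathsf{INV}}\log n\ge1$, $\mu_{\mathsf{INV}}(n)=\mathrm{poly}(n)$ and $c_{\mathsf{INV}}$ is a constant. Sign function: if $A$ has no purely imaginary eigenvalues, with Jordan form $A=V\begin{bmatrix}N&\\&P\end{bmatrix}V^{-1}$ where $N$ (resp. $P$) has eigenvalues with strictly negative (resp. positive) real part, then $\mathrm{sgn}(A)=V\begin{bmatrix}-I_N&\\&I_P\end{bmatrix}V^{-1}$, where $I_N,I_P$ are identities of the sizes of $N,P$. Pseudospectrum: $\Lambda_\epsilon(M)=\{\lambda\in\mathbb{C}:\|(\lambda-M)^{-1}\|>1/\epsilon\}$ (including the spectrum, where the norm is taken to be $\infty$). Condition number of the sign function: $\kappa_{\mathrm{sign}}(M):=\inf\{1/\epsilon^2:\Lambda_\epsilon(M)\text{ does not intersect the imaginary axis}\}$.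
   Formalization: In both O-bounds, log K is read as log max(K,2): at K = 1 (for example A = diag(1,-1)) the literal bound would allow zero bits of precision, for which the claim fails; for K ≥ 2 nothing changes. *)

(* Defs.v *)
From mathcomp Require Import all_boot all_order all_algebra.
From mathcomp Require Import all_classical all_reals all_analysis.

Set Implicit Arguments.
Unset Strict Implicit.
Unset Printing Implicit Defensive.

Import Order.TTheory GRing.Theory Num.Theory.
(* after Num.Theory, so that Re is the projection R[i] -> R *)
From mathcomp Require Import complex.
Import Normc.

Local Open Scope classical_set_scope.
Local Open Scope complex_scope.
Local Open Scope ring_scope.

Section MatrixNotions.
Variable R : realType.
Local Notation C := R[i].

Definition l2norm n (x : 'cV[C]_n) : R :=
  Num.sqrt (\sum_i normc (x i ord0) ^+ 2).

(* Spectral norm, as the operator norm of the Euclidean norm. *)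
Definition opnorm n (A : 'M[C]_n) : R :=
  sup [set l2norm (A *m x) | x in [set x : 'cV[C]_n | l2norm x <= 1]].

Definition cond n (A : 'M[C]_n) : R := opnorm A * opnorm (invmx A).

Definition pseudospectrum n (e : R) (M : 'M[C]_n) : set C :=
  [set z | z%:M - M \notin unitmx \/ 1 / e < opnorm (invmx (z%:M - M))].

Definition imaginary_axis : set C := [set z | Re z = 0].

(* Extended-real infimum: [+oo] when no pseudospectrum avoids the axis. *)
Definition kappa_sign n (M : 'M[C]_n) : \bar R :=
  ereal_inf [set (1 / e ^+ 2)%:E |
    e in [set e : R | 0 < e /\ pseudospectrum e M `&` imaginary_axis = set0]].

Definition is_jordan n (J : 'M[C]_n) : Prop :=
  (forall i j : 'I_n, j != i -> j != i.+1 :> nat -> J i j = 0) /\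
  (forall i j : 'I_n, j = i.+1 :> nat ->
     J i j = 0 \/ (J i j = 1 /\ J i i = J j j)).

(* [is_sgn A S] : S is the value of sgn(A) read off some Jordan form
   A = V diag(N, P) V^-1 with N, P in the open left, right half planes. *)
Definition is_sgn n (A S : 'M[C]_n) : Prop :=
  exists (p q : nat) (e : (p + q = n)%N) (V : 'M[C]_(p + q))
         (N : 'M[C]_p) (P : 'M[C]_q),
  [/\ V \in unitmx,
      is_jordan (block_mx N 0 0 P),
      (forall z, eigenvalue N z -> Re z < 0) /\
      (forall z, eigenvalue P z -> 0 < Re z),
      A = castmx (e, e) (V *m block_mx N 0 0 P *m invmx V) &
      S = castmx (e, e) (V *m block_mx (- 1%:M) 0 0 1%:M *m invmx V)].

Definition lg (x : R) : R := ln x / ln 2.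

End MatrixNotions.

(* A WHILE language for floating point algorithms. Natural number variables
   are used for indices and loop counters. Floating point numbers live in
   unbounded two-dimensional arrays a, with cells [Loc a i j]. Each executed
   [FSet] and each [FLt] test counts as one operation; bookkeeping on natural
   numbers and exact copies are free. *)
Inductive nexp :=
| NVar of nat
| NCst of nat
| NAdd of nexp & nexp
| NSub of nexp & nexp
| NMul of nexp & nexp.

Inductive loc := Loc of nat & nexp & nexp.

Inductive fop := FAdd | FSub | FMul | FDiv.

Inductive fexp :=
| FCst of nexp & nexp          (* the constant m + i n *)
| FConj of loc
| FSqrt of loc
| FBin of fop & loc & loc.

Inductive test :=
| NLt of nexp & nexp
| FLt of loc & loc.            (* compares real parts *)

Inductive cmd :=
| Skip
| Seq of cmd & cmd
| NSet of nat & nexp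
| FSet of loc & fexp           (* rounded *)
| FCopy of loc & loc           (* exact *)
| FEps of loc                  (* loads the machine precision *)
| If of test & cmd & cmd
| While of test & cmd
| Call of cmd & nexp & nat & nat.
  (* [Call c d a b]: runs the procedure c in a fresh memory on the d x d
     matrix in array a and stores its result in array b *)

Section Semantics.
Variable R : realType.
Local Notation C := R[i].

Definition arr := nat -> nat -> C.

Definition arr_of_mx n (A : 'M[C]_n) : arr := fun i j =>
  match insub i, insub j with
  | Some i', Some j' => A i' j'
  | _, _ => 0
  end.

Definition mx_of_arr n (a : arr) : 'M[C]_n := \matrix_(i, j) a i j.

(* [ops] is the number of floating point operations performed so far. *)
Record state := State { nvar : nat -> nat; fmem : nat -> arr; ops : nat }.

Definition upd (T : Type) (f : nat -> T) (x : nat) (v : T) : nat -> T :=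
  fun y => if y == x then v else f y.

(* Procedures find the dimension in variable 0, their k-th input in array k,
   and leave their result in array 0. *)
Definition init (n : nat) (inputs : seq arr) (k : nat) : state :=
  State (upd (fun=> 0%N) 0%N n) (nth (fun _ _ => 0) inputs) k.

Fixpoint neval (s : state) (e : nexp) : nat :=
  match e with
  | NVar x => nvar s x
  | NCst k => k
  | NAdd e1 e2 => neval s e1 + neval s e2
  | NSub e1 e2 => neval s e1 - neval s e2
  | NMul e1 e2 => neval s e1 * neval s e2
  end%N.

Definition get (s : state) (l : loc) : C :=
  let: Loc a i j := l in fmem s a (neval s i) (neval s j).

Definition put (s : state) (l : loc) (x : C) : nat -> arr :=
  let: Loc a i j := l in
  upd (fmem s) a
    (upd (fmem s a) (neval s i) (upd (fmem s a (neval s i)) (neval s j) x)).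

(* Exact value of a floating point operation; division by zero and square
   roots of negative reals have no value, and block the execution. *)
Definition feval (s : state) (f : fexp) : option C :=
  match f with
  | FCst m n => Some ((neval s m)%:R +i* (neval s n)%:R)
  | FConj l => Some (conjc (get s l))
  | FSqrt l => if 0 <= Re (get s l)
               then Some (Num.sqrt (Re (get s l)))%:C else None
  | FBin FAdd l1 l2 => Some (get s l1 + get s l2)
  | FBin FSub l1 l2 => Some (get s l1 - get s l2)
  | FBin FMul l1 l2 => Some (get s l1 * get s l2)
  | FBin FDiv l1 l2 => if get s l2 == 0 then None
                       else Some (get s l1 / get s l2)
  end.

Definition teval (s : state) (t : test) : bool :=
  match t with
  | NLt e1 e2 => (neval s e1 < neval s e2)%N
  | FLt l1 l2 => Re (get s l1) < Re (get s l2)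
  end.

Definition tick (s : state) (t : test) : state :=
  match t with
  | NLt _ _ => s
  | FLt _ _ => State (nvar s) (fmem s) (ops s).+1
  end.

(* Big-step semantics with machine precision u. The relative error committed
   by the k-th floating point operation is d k: since programs are
   deterministic, quantifying over all streams d bounded by u amounts to
   quantifying over all (adaptive) adversaries. A derivation of
   [exec u d c s s'] witnesses the termination of c. *)
Inductive exec (u : R) (d : nat -> C) : cmd -> state -> state -> Prop :=
| exec_skip s : exec u d Skip s s
| exec_seq c1 c2 s s1 s2 :
    exec u d c1 s s1 -> exec u d c2 s1 s2 -> exec u d (Seq c1 c2) s s2
| exec_nset x e s :
    exec u d (NSet x e) s (State (upd (nvar s) x (neval s e)) (fmem s) (ops s))
| exec_fset l f s x :
    feval s f = Some x ->
    exec u d (FSet l f) s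
      (State (nvar s) (put s l (x * (1 + d (ops s)))) (ops s).+1)
| exec_fcopy l l1 s :
    exec u d (FCopy l l1) s (State (nvar s) (put s l (get s l1)) (ops s))
| exec_feps l s :
    exec u d (FEps l) s (State (nvar s) (put s l u%:C) (ops s))
| exec_if t c1 c2 s s' :
    exec u d (if teval s t then c1 else c2) (tick s t) s' ->
    exec u d (If t c1 c2) s s'
| exec_while_false t c s :
    ~~ teval s t -> exec u d (While t c) s (tick s t)
| exec_while_true t c s s1 s2 :
    teval s t -> exec u d c (tick s t) s1 -> exec u d (While t c) s1 s2 ->
    exec u d (While t c) s s2
| exec_call c e a b s s' :
    exec u d c
      (init (neval s e) [:: arr_of_mx (mx_of_arr (neval s e) (fmem s a))]
         (ops s)) s' ->
    exec u d (Call c e a b) s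
      (State (nvar s)
         (upd (fmem s) b (arr_of_mx (mx_of_arr (neval s e) (fmem s' 0%N))))
         (ops s')).

Lemma exec_det u d c s s1 s2 :
  exec u d c s s1 -> exec u d c s s2 -> s1 = s2.
Proof.
move=> h; elim: h s2 => {c s s1}.
- by move=> s s2 h; inversion h.
- move=> c1 c2 s s1 s2 _ IH1 _ IH2 s3 h.
  inversion h as [|? ? ? s1' ? h1 h2| | | | | | | |]; subst.
  by apply: IH2; rewrite (IH1 _ h1).
- by move=> x e s s2 h; inversion h.
- move=> l f s x fx s2 h.
  inversion h as [| | |? ? ? x' fx'| | | | | |]; subst.
  by move: fx'; rewrite fx => -[->].
- by move=> l l1 s s2 h; inversion h.
- by move=> l s s2 h; inversion h.
- move=> t c1 c2 s s' _ IH s2 h; inversion h; subst; exact: IH.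
- move=> t c s tF s2 h; inversion h as [| | | | | | | |? ? ? ? ? tT|] => //.
  by rewrite tT in tF.
- move=> t c s s1 s2 tT _ IH1 _ IH2 s3 h.
  inversion h as [| | | | | | |? ? ? tF|? ? ? s1' ? _ h1 h2|]; subst.
    by rewrite tT in tF.
  by apply: IH2; rewrite (IH1 _ h1).
- move=> c e a b s s' _ IH s2 h.
  inversion h as [| | | | | | | | |? ? ? ? ? s'' h1]; subst.
  by rewrite (IH _ h1).
Qed.

Definition adversary (u : R) (d : nat -> C) : Prop := forall k, normc (d k) <= u.

Definition stored (u : R) (x x' : C) : Prop :=
  exists2 D : C, normc D <= u & x' = (1 + D) * x.

Definition stored_mx (u : R) n (A A' : 'M[C]_n) : Prop :=
  forall i j, stored u (A i j) (A' i j).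

Definition scalar_arr (x : C) : arr := arr_of_mx (const_mx x : 'M[C]_1).

Definition stable_inversion
    (INV : cmd) (mu : nat -> R) (c : R) (T : nat -> nat) : Prop :=
  forall (n : nat) (A A' : 'M[C]_n) (u : R) (d : nat -> C),
  (1 < n)%N -> A \in unitmx -> 0 < u < 1 -> stored_mx u A A' ->
  adversary u d ->
  exists s : state,
  [/\ exec u d INV (init n [:: arr_of_mx A'] 0) s,
      (ops s <= T n)%N &
      opnorm (mx_of_arr n (fmem s 0%N) - invmx A)
        <= mu n * u * (cond A `^ (c * ln n%:R)) * opnorm (invmx A)].

End Semantics.

(* Main.v *)
Require Import Defs.
From mathcomp Require Import all_boot all_order all_algebra.
From mathcomp Require Import all_classical all_reals all_analysis.
From mathcomp Require Import perm ring lra zify.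

Set Implicit Arguments.
Unset Strict Implicit.
Unset Printing Implicit Defensive.

Import Order.TTheory GRing.Theory Num.Theory.
From mathcomp Require Import complex.
Import Normc.

Local Open Scope complex_scope.
Local Open Scope ring_scope.

(** Write X = coth w. The Newton map X |-> (X + X^-1) / 2 sends coth w to
    coth 2w, so it commutes, up to halving t, with the rotations
    X_t = coth (w + i t) = (cos t X + i sin t) (cos t + i sin t X)^-1,
    which exist for every real t exactly when X has no eigenvalue on the
    imaginary axis. Concretely (rot_newton), the rotation by t of the Newton
    iterate of X is the average of the rotations of X by t/2 and t/2 + pi/2.
    Hence, for the supremum over t of a quantity attached to X_t:

    - the bound sup ||X_t|| never increases along the iteration. Since X_0 = X
      and X_(pi/2) = X^-1, all iterates and their inverses are bounded by it. At
      the input it is O(K), because kappa_sign controls the resolvent on the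
      imaginary axis (initial_rot_bounded);

    - the distance sup ||X_t - Y_t|| never increases either, and adding E to X
      moves X_t by O((1 + sup ||X_t||)^2 ||E||) (axis_free_perturb). Rounding
      errors are therefore not amplified: after q steps they add up to q times
      the error of one step (tracks_step);

    - the Lipschitz constant of t |-> X_t is halved by each step. Therefore
      X - X^-1 = X_0 - X_(pi/2) decays geometrically.

    With G_k the product of the k-th iterate and S = sgn A, the spectrum of G_k
    remains in the right half plane, so G_k + 1 stays invertible with a bounded
    inverse, and the decay of G_k^2 - 1 identifies S as the limit. Summing the
    steps bounds the error after k steps by O(K^4 / 2^k) (iterate_linear); once
    it is below a small multiple of 1 / K, it is squared at each further step.
    This gives O(log K + log log (1/beta)) Newton steps (iterate_accuracy).

    The program finds this number of steps by comparing K and 1 / beta with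
    2^m and 2^(2^m), then runs the steps. One of them costs an inversion
    and 2 n^2 further operations. The latter are absorbed by T n: copies produce
    no new value, so an inversion must compute each of the many distinct entries
    of the inverse of a suitable matrix (stable_inversion_ops_ge). The condition
    number of every iterate is O(K^2), so a step commits an error of at most u
    times exp(O(log n log K)), and the precision makes the sum of all errors
    less than beta / 2 (small_precision). *)

(** * Euclidean and spectral norms *)

Ltac abstract_norms :=
  repeat match goal with
  | H : context [@opnorm _ _ _] |- _ => revert H
  | H : context [@l2norm _ _ _] |- _ => revert H
  end;
  repeat match goal with
  | |- context [@opnorm ?R ?n ?A] => generalize (@opnorm R n A)
  | |- context [@l2norm ?R ?n ?A] => generalize (@l2norm R n A)
  end; intros.

Section Norms.
Variable R : realType.
Local Notation C := R[i].

Lemma normc_ge0 (z : C) : 0 <= normc z.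
Proof. by case: z => a b; rewrite sqrtr_ge0. Qed.

Lemma normc_real (x : R) : normc x%:C = `|x|.
Proof. by rewrite /normc /= expr0n addr0 sqrtr_sqr. Qed.

Lemma normc_half : normc (2^-1 : C) = 2^-1.
Proof.
have -> : (2^-1 : C) = (2^-1 : R)%:C by rewrite fmorphV /= rmorph_nat.
by rewrite normc_real ger0_norm.
Qed.

Lemma normc_sum (I : finType) (f : I -> C) : normc (\sum_i f i) <= \sum_i normc (f i).
Proof.
elim/big_ind2: _ => [|a b c d h1 h2|//]; first by rewrite normc0.
exact: le_trans (le_normcD _ _) (lerD h1 h2).
Qed.

Lemma ler_Re_normc (z : C) : `|Re z| <= normc z.
Proof.
case: z => a b /=; rewrite -sqrtr_sqr ler_sqrt ?addr_ge0 ?sqr_ge0 //.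
by rewrite lerDl sqr_ge0.
Qed.

(** The sum over i, j of (a_i b_j - a_j b_i)^2 is nonnegative. *)
Lemma sum_cauchy_schwarz (I : finType) (a b : I -> R) :
  (\sum_i a i * b i) ^+ 2 <= (\sum_i a i ^+ 2) * (\sum_i b i ^+ 2).
Proof.
have h : 0 <= \sum_i \sum_j (a i * b j - a j * b i) ^+ 2.
  by apply: sumr_ge0 => i _; apply: sumr_ge0 => j _; rewrite sqr_ge0.
have E : \sum_i \sum_j (a i * b j - a j * b i) ^+ 2 =
    ((\sum_i a i ^+ 2) * (\sum_i b i ^+ 2) - (\sum_i a i * b i) ^+ 2) *+ 2.
  have mm (f g : I -> R) : (\sum_i f i) * (\sum_i g i) = \sum_i \sum_j f i * g j.
    by rewrite mulr_suml; apply: eq_bigr => i _; rewrite mulr_sumr.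
  transitivity ((\sum_i a i ^+ 2) * (\sum_i b i ^+ 2)
    + (\sum_i b i ^+ 2) * (\sum_i a i ^+ 2) - ((\sum_i a i * b i) ^+ 2) *+ 2); last by ring.
  rewrite expr2 !mm -sumrMnl -sumrN -!big_split /=; apply: eq_bigr => i _.
  rewrite -sumrMnl -sumrN -!big_split /=; apply: eq_bigr => j _; ring.
by move: h; rewrite E; lra.
Qed.

Lemma minkowski2 (I : finType) (a b : I -> R) :
  Num.sqrt (\sum_i (a i + b i) ^+ 2) <=
  Num.sqrt (\sum_i a i ^+ 2) + Num.sqrt (\sum_i b i ^+ 2).
Proof.
set A := \sum_i a i ^+ 2; set B := \sum_i b i ^+ 2.
have A0 : 0 <= A by apply: sumr_ge0 => i _; rewrite sqr_ge0.
have B0 : 0 <= B by apply: sumr_ge0 => i _; rewrite sqr_ge0.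
rewrite -(ler_pXn2r (n := 2)) ?nnegrE ?addr_ge0 ?sqrtr_ge0 //.
rewrite sqr_sqrtr; last by apply: sumr_ge0 => i _; rewrite sqr_ge0.
rewrite sqrrD !sqr_sqrtr //.
have -> : \sum_i (a i + b i) ^+ 2 = A + (\sum_i a i * b i) *+ 2 + B.
  rewrite -sumrMnl /A /B -!big_split /=; apply: eq_bigr => i _; ring.
rewrite lerD2r lerD2l lerMn2r /= -sqrtrM //.
apply: le_trans (ler_norm _) _.
by rewrite -sqrtr_sqr; apply: ler_wsqrtr; apply: sum_cauchy_schwarz.
Qed.

Lemma l2norm_ge0 n (x : 'cV[C]_n) : 0 <= l2norm x.
Proof. exact: sqrtr_ge0. Qed.

Lemma l2norm0 n : l2norm (0 : 'cV[C]_n) = 0.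
Proof.
rewrite /l2norm big1 ?sqrtr0 // => i _.
by rewrite mxE normc0 expr0n.
Qed.

Lemma l2normZ n a (x : 'cV[C]_n) : l2norm (a *: x) = normc a * l2norm x.
Proof.
rewrite /l2norm -[normc a]ger0_norm ?normc_ge0 // -sqrtr_sqr -sqrtrM ?sqr_ge0 //.
congr Num.sqrt; rewrite mulr_sumr; apply: eq_bigr => i _.
by rewrite mxE normcM exprMn.
Qed.

Lemma l2normN n (x : 'cV[C]_n) : l2norm (- x) = l2norm x.
Proof. by rewrite -scaleN1r l2normZ normcN normc1 mul1r. Qed.

Lemma l2normD n (x y : 'cV[C]_n) : l2norm (x + y) <= l2norm x + l2norm y.
Proof.
rewrite /l2norm; apply: le_trans (minkowski2 _ _).
rewrite ler_wsqrtr //; apply: ler_sum => i _.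
by rewrite mxE ler_pXn2r ?nnegrE ?addr_ge0 ?normc_ge0 // le_normcD.
Qed.

Lemma l2norm_entry n (x : 'cV[C]_n) i : normc (x i ord0) <= l2norm x.
Proof.
rewrite -[leLHS]ger0_norm ?normc_ge0 // -sqrtr_sqr ler_wsqrtr //.
by rewrite (bigD1 i) //= lerDl sumr_ge0 // => j _; rewrite sqr_ge0.
Qed.

Lemma l2norm_eq0 n (x : 'cV[C]_n) : l2norm x <= 0 -> x = 0.
Proof.
move=> x0; apply/colP => i; rewrite mxE; apply: eq0_normc.
by apply/eqP; rewrite eq_le normc_ge0 andbT (le_trans (l2norm_entry x i)).
Qed.

Lemma l2norm_delta n (j : 'I_n) : l2norm (delta_mx j ord0 : 'cV[C]_n) = 1.
Proof.
rewrite /l2norm (bigD1 j) //= big1 ?addr0.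
  by rewrite mxE !eqxx normc1 expr1n sqrtr1.
by move=> i ij; rewrite mxE (negPf ij) normc0 expr0n.
Qed.

Lemma l2norm_mulmx_le n (A : 'M[C]_n) (b : R) (x : 'cV[C]_n) :
  0 <= b -> (forall i j, normc (A i j) <= b) ->
  l2norm (A *m x) <= n%:R * b * l2norm x.
Proof.
move=> b0 Ab.
have nb0 : 0 <= n%:R * b by rewrite mulr_ge0.
rewrite /l2norm -[n%:R * b]ger0_norm // -sqrtr_sqr -sqrtrM ?sqr_ge0 //.
apply: ler_wsqrtr.
set X := \sum_i normc (x i ord0) ^+ 2.
have H i : normc ((A *m x) i ord0) ^+ 2 <= n%:R * b ^+ 2 * X.
  apply: (@le_trans _ _ ((\sum_j b * normc (x j ord0)) ^+ 2)).
    rewrite ler_pXn2r ?nnegrE ?normc_ge0 //; last first.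
      by apply: sumr_ge0 => j _; rewrite mulr_ge0 ?normc_ge0.
    rewrite mxE; apply: le_trans (normc_sum _) _.
    by apply: ler_sum => j _; rewrite normcM ler_wpM2r ?normc_ge0.
  apply: le_trans (sum_cauchy_schwarz _ _) _.
  by rewrite sumr_const card_ord mulr_natl.
apply: le_trans (ler_sum _ (fun i _ => H i)) _.
rewrite sumr_const card_ord -mulr_natl le_eqVlt; apply/orP; left; apply/eqP; ring.
Qed.

Definition has_opnorm n (A : 'M[C]_n) :
  has_sup [set l2norm (A *m x) | x in [set x : 'cV[C]_n | l2norm x <= 1]]%classic.
Proof.
split; first by exists (l2norm (A *m 0)), 0 => //=; rewrite l2norm0.
exists (n%:R * (\sum_i \sum_j normc (A i j)) * 1) => _ [x /= x1 <-].
have b0 : 0 <= \sum_i \sum_j normc (A i j).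
  by apply: sumr_ge0 => i _; apply: sumr_ge0 => j _; rewrite normc_ge0.
apply: le_trans (l2norm_mulmx_le _ b0 _) _.
  move=> i j; rewrite (bigD1 i) //= (bigD1 j) //= -addrA lerDl addr_ge0 //.
    by apply: sumr_ge0 => k _; rewrite normc_ge0.
  by apply: sumr_ge0 => k _; apply: sumr_ge0 => l _; rewrite normc_ge0.
by rewrite ler_wpM2l // mulr_ge0.
Qed.

Lemma opnorm_le n (A : 'M[C]_n) (b : R) :
  0 <= b -> (forall x, l2norm (A *m x) <= b * l2norm x) -> opnorm A <= b.
Proof.
move=> b0 Ab; apply: sup_le_ub; first by case: (has_opnorm A).
move=> _ [x /= x1 <-]; apply: le_trans (Ab x) _.
by rewrite -[leRHS]mulr1 ler_wpM2l.
Qed.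

Lemma opnorm_ge0 n (A : 'M[C]_n) : 0 <= opnorm A.
Proof.
have := ub_le_sup (has_opnorm A).2; apply; exists 0; rewrite /= ?l2norm0 //.
by rewrite mulmx0 l2norm0.
Qed.

Lemma l2norm_mulmx n (A : 'M[C]_n) (x : 'cV[C]_n) :
  l2norm (A *m x) <= opnorm A * l2norm x.
Proof.
have [x0|x0] := leP (l2norm x) 0.
  by rewrite (l2norm_eq0 x0) mulmx0 l2norm0 mulr0.
rewrite -ler_pdivrMr // mulrC.
have -> : (l2norm x)^-1 * l2norm (A *m x) = l2norm (A *m ((l2norm x)^-1%:C *: x)).
  by rewrite -scalemxAr l2normZ normc_real ger0_norm // invr_ge0 ltW.
apply: (ub_le_sup (has_opnorm A).2); exists ((l2norm x)^-1%:C *: x) => //=.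
rewrite l2normZ normc_real ger0_norm ?invr_ge0 ?(ltW x0) //.
by rewrite mulVf ?lexx ?lt0r_neq0.
Qed.

Lemma opnormD n (A B : 'M[C]_n) : opnorm (A + B) <= opnorm A + opnorm B.
Proof.
apply: opnorm_le => [|x]; first by rewrite addr_ge0 ?opnorm_ge0.
rewrite mulmxDl mulrDl; apply: le_trans (l2normD _ _) _.
by rewrite lerD // l2norm_mulmx.
Qed.

Lemma opnormM n (A B : 'M[C]_n) : opnorm (A *m B) <= opnorm A * opnorm B.
Proof.
apply: opnorm_le => [|x]; first by rewrite mulr_ge0 ?opnorm_ge0.
rewrite -mulmxA -mulrA; apply: le_trans (l2norm_mulmx _ _) _.
by rewrite ler_wpM2l ?opnorm_ge0 // l2norm_mulmx.
Qed.

Lemma opnorm0 n : opnorm (0 : 'M[C]_n) = 0.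
Proof.
apply/eqP; rewrite eq_le opnorm_ge0 andbT; apply: opnorm_le => // x.
by rewrite mul0mx l2norm0 mul0r.
Qed.

Lemma opnormZ n a (A : 'M[C]_n) : opnorm (a *: A) <= normc a * opnorm A.
Proof.
apply: opnorm_le => [|x]; first by rewrite mulr_ge0 ?opnorm_ge0 ?normc_ge0.
by rewrite -scalemxAl l2normZ -mulrA ler_wpM2l ?normc_ge0 // l2norm_mulmx.
Qed.

Lemma opnormN n (A : 'M[C]_n) : opnorm (- A) = opnorm A.
Proof.
have H (B : 'M[C]_n) : opnorm (- B) <= opnorm B.
  by rewrite -scaleN1r; apply: le_trans (opnormZ _ _) _; rewrite normcN normc1 mul1r.
apply: le_anti; apply/andP; split; first exact: (H A).
by have := H (- A); rewrite opprK.
Qed.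

Lemma opnormB n (A B : 'M[C]_n) : opnorm (A - B) <= opnorm A + opnorm B.
Proof. by rewrite -[opnorm B]opnormN; apply: opnormD. Qed.

Lemma opnorm_triangle n (B A D : 'M[C]_n) :
  opnorm (A - D) <= opnorm (A - B) + opnorm (B - D).
Proof. by rewrite -[A - D](subrKA B) opnormD. Qed.

Lemma opnorm1_le n : opnorm (1%:M : 'M[C]_n) <= 1.
Proof. by apply: opnorm_le => // x; rewrite mul1mx mul1r. Qed.

Lemma opnorm_scalar n a : opnorm (a%:M : 'M[C]_n) <= normc a.
Proof. by apply: opnorm_le => [|x]; rewrite ?normc_ge0 // mul_scalar_mx l2normZ. Qed.

Lemma normc_entry n (A : 'M[C]_n) i j : normc (A i j) <= opnorm A.
Proof.
have := l2norm_mulmx A (delta_mx j ord0); rewrite l2norm_delta mulr1.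
apply: le_trans; rewrite -colE.
by have := l2norm_entry (col j A) i; rewrite mxE.
Qed.

Lemma opnorm_entries n (A : 'M[C]_n) b :
  0 <= b -> (forall i j, normc (A i j) <= b) -> opnorm A <= n%:R * b.
Proof.
by move=> b0 Ab; apply: opnorm_le => [|x]; [rewrite mulr_ge0|exact: l2norm_mulmx_le].
Qed.

Lemma opnormD_le n (A B : 'M[C]_n) a b :
  opnorm A <= a -> opnorm B <= b -> opnorm (A + B) <= a + b.
Proof. by move=> hA hB; apply: le_trans (opnormD _ _) _; apply: lerD. Qed.

Lemma opnormB_le n (A B : 'M[C]_n) a b :
  opnorm A <= a -> opnorm B <= b -> opnorm (A - B) <= a + b.
Proof. by move=> hA hB; apply: le_trans (opnormB _ _) _; apply: lerD. Qed.

Lemma opnormM_le n (A B : 'M[C]_n) a b :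
  opnorm A <= a -> opnorm B <= b -> opnorm (A *m B) <= a * b.
Proof.
move=> hA hB; apply: le_trans (opnormM _ _) _.
by apply: ler_pM => //; apply: opnorm_ge0.
Qed.

Lemma opnormZ_le n z (A : 'M[C]_n) a b :
  normc z <= a -> opnorm A <= b -> opnorm (z *: A) <= a * b.
Proof.
move=> hz hA; apply: le_trans (opnormZ _ _) _.
by apply: ler_pM => //; [apply: normc_ge0|apply: opnorm_ge0].
Qed.

(** The kernel is trivial, and y = D x reads ||D^-1 y|| <= ||y|| / m. Lower
    bounds on ||D x|| are stable under perturbation of D, so this does the work
    of a Neumann series without any limit. *)
Lemma expanding_unitmx n (D : 'M[C]_n) (m : R) :
  0 < m -> (forall x, m * l2norm x <= l2norm (D *m x)) ->
  D \in unitmx /\ opnorm (invmx D) <= m^-1.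
Proof.
move=> m0 Dm.
have uD : D \in unitmx.
  rewrite -unitmx_tr -row_free_unit -kermx_eq0; apply/eqP/row_matrixP => i.
  rewrite row0; set v := row i _.
  have : D *m v^T = 0.
    apply: trmx_inj; rewrite trmx_mul trmxK trmx0 /v -row_mul mulmx_ker row0 //.
  move=> Dv; have := Dm v^T; rewrite Dv l2norm0 pmulr_rle0 // => /l2norm_eq0.
  by move=> h; apply: trmx_inj; rewrite h trmx0.
split=> //; apply: opnorm_le => [|x]; first by rewrite invr_ge0 ltW.
rewrite ler_pdivlMl //; apply: le_trans (Dm _) _.
by rewrite mulKVmx.
Qed.

Lemma unitmx_expanding n (D : 'M[C]_n) x :
  D \in unitmx -> l2norm x <= opnorm (invmx D) * l2norm (D *m x).
Proof. by move=> uD; rewrite -{1}[x](mulKmx uD); apply: l2norm_mulmx. Qed.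

End Norms.

(** * Rotations of a matrix and the Newton map *)

Section SineBound.
Import numFieldNormedType.Exports.

Lemma sin_le_id (R : realType) (x : R) : 0 <= x -> sin x <= x.
Proof.
move=> x0.
have [c _] : exists2 c, c \in `[0, x] & sin x - sin 0 = cos c * (x - 0).
  apply: (MVT_segment x0).
  by apply: continuous_subspaceT; apply: continuous_sin.
rewrite sin0 !subr0 => ->.
by rewrite -[leRHS]mul1r ler_wpM2r // cos_le1.
Qed.

Lemma norm_sin_le (R : realType) (x : R) : `|sin x| <= `|x|.
Proof.
have H (y : R) : 0 <= y -> `|sin y| <= y.
  move=> y0; rewrite ler_norml sin_le_id // andbT.
  have [y1|y1] := leP y 1; last by have := sin_geN1 y; lra.
  rewrite lerNl; apply: (le_trans _ y0).
  rewrite oppr_le0; apply: sin_ge0_pi; rewrite y0 /=.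
  by apply: (le_trans y1); apply: le_trans (pi_ge2 R); rewrite ler1n.
have [x0|x0] := leP 0 x; first by rewrite [leRHS]ger0_norm // H.
by rewrite -normrN -sinN [leRHS]ltr0_norm // H; lra.
Qed.

End SineBound.

Section Rotation.
Variable R : realType.
Local Notation C := R[i].

Definition moebius_den n (c w : C) (X : 'M[C]_n) := c%:M + w *: X.
Definition moebius_num n (c w : C) (X : 'M[C]_n) := w%:M + c *: X.

Lemma mul_den_num n (c w c' w' : C) (X Y : 'M[C]_n) :
  moebius_den c w X *m moebius_num c' w' Y =
  (c * c') *: Y + (c * w')%:M + (w * c') *: (X *m Y) + (w * w') *: X.
Proof.
rewrite /moebius_den /moebius_num mulmxDl !mulmxDr -!scalemxAl !mul_scalar_mx -!scalemxAr mul_mx_scalar.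
by apply/matrixP => i j; rewrite !mxE; ring.
Qed.

Lemma mul_num_den n (c w c' w' : C) (X Y : 'M[C]_n) :
  moebius_num c w X *m moebius_den c' w' Y =
  (c * c') *: X + (w * c')%:M + (c * w') *: (X *m Y) + (w * w') *: Y.
Proof.
rewrite /moebius_den /moebius_num mulmxDl !mulmxDr -!scalemxAl !mul_scalar_mx -!scalemxAr mul_mx_scalar.
by apply/matrixP => i j; rewrite !mxE; ring.
Qed.

Lemma den_num_comm n (c w : C) (X : 'M[C]_n) :
  moebius_den c w X *m moebius_num c w X = moebius_num c w X *m moebius_den c w X.
Proof.
rewrite mul_den_num mul_num_den.
by apply/matrixP => i j; rewrite !mxE; ring.
Qed.

(** The functions cosh and sinh at i t. *)
Definition cosC (t : R) : C := (cos t)%:C.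
Definition isinC (t : R) : C := 0 +i* sin t.

Lemma cosC2_isinC2 t : cosC t * cosC t - isinC t * isinC t = 1.
Proof.
have := cos2Dsin2 t; rewrite /cosC /isinC; simpc => h.
by apply/eqP; rewrite eq_complex /= -h; apply/andP; split; apply/eqP; ring.
Qed.

Lemma normc_cosC t : normc (cosC t) <= 1.
Proof. by rewrite normc_real cos_max. Qed.

Lemma normc_imag (x : R) : normc (0 +i* x) = `|x|.
Proof. by rewrite /normc expr0n add0r sqrtr_sqr. Qed.

Lemma normc_isinC t : normc (isinC t) <= 1.
Proof. by rewrite normc_imag sin_max. Qed.

Definition rot_den n t (X : 'M[C]_n) := moebius_den (cosC t) (isinC t) X.
Definition rot_num n t (X : 'M[C]_n) := moebius_num (cosC t) (isinC t) X.
(** For X = coth w, the matrix coth (w + i t). *)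
Definition rotm n t (X : 'M[C]_n) := rot_num t X *m invmx (rot_den t X).

(** No eigenvalue of X lies on the imaginary axis: the denominator at t is
    singular when i cot t is an eigenvalue of X. *)
Definition axis_free n (X : 'M[C]_n) := forall t, rot_den t X \in unitmx.
Definition rot_bounded n (B : R) (X : 'M[C]_n) := forall t, opnorm (rotm t X) <= B.
Definition rot_near n (e : R) (X Y : 'M[C]_n) :=
  forall t, opnorm (rotm t X - rotm t Y) <= e.

Lemma den_numC n t (X : 'M[C]_n) : rot_den t X *m rot_num t X = rot_num t X *m rot_den t X.
Proof. exact: den_num_comm. Qed.

Lemma rotK n t (X : 'M[C]_n) : axis_free X -> rotm t X *m rot_den t X = rot_num t X.
Proof. by move=> uX; rewrite /rotm mulmxKV. Qed.

Lemma den_rot n t (X : 'M[C]_n) : axis_free X -> rot_den t X *m rotm t X = rot_num t X.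
Proof. by move=> uX; rewrite /rotm mulmxA den_numC mulmxK. Qed.

Lemma rot_uniq n t (X Y : 'M[C]_n) : axis_free X ->
  Y *m rot_den t X = rot_num t X -> Y = rotm t X.
Proof. by move=> uX h; rewrite /rotm -h mulmxK. Qed.

Lemma rotm0 n (X : 'M[C]_n) : rotm 0 X = X.
Proof.
have -> : rotm 0 X = rot_num 0 X *m invmx 1%:M.
  rewrite /rotm /rot_den /moebius_den /isinC /cosC cos0 sin0; congr (_ *m invmx _).
  by rewrite -[0 +i* 0]/(0 : C) scale0r addr0.
rewrite invmx1 mulmx1 /rot_num /moebius_num /isinC /cosC cos0 sin0.
by rewrite -[0 +i* 0]/(0 : C) scale1r -scalemx1 scale0r add0r.
Qed.

Lemma den_pihalf n (X : 'M[C]_n) : rot_den (pi / 2) X = 'i *: X.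
Proof.
rewrite /rot_den /moebius_den /isinC /cosC cos_pihalf sin_pihalf.
by apply/matrixP => i j; rewrite !mxE mul0rn add0r.
Qed.

Lemma axis_free_unitmx n (X : 'M[C]_n) : axis_free X -> X \in unitmx.
Proof.
move=> /(_ (pi / 2)); rewrite den_pihalf => h.
have -> : X = (- 'i) *: ('i *: X).
  by rewrite scalerA mulNr -expr2 sqr_i opprK scale1r.
by rewrite unitmxZ // unitfE oppr_eq0; apply/eqP => -[/eqP]; rewrite oner_eq0.
Qed.

Lemma rot_pihalf n (X : 'M[C]_n) : axis_free X -> rotm (pi / 2) X = invmx X.
Proof.
move=> uX; apply/esym/rot_uniq => //; rewrite den_pihalf -scalemxAr mulVmx ?axis_free_unitmx //.
rewrite /rot_num /moebius_num /isinC /cosC cos_pihalf sin_pihalf.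
by apply/matrixP => i j; rewrite !mxE mul0r addr0 mulr_natr.
Qed.

Definition newton n (X : 'M[C]_n) := 2^-1 *: (X + invmx X).

Lemma half_angles (t : R) :
  cosC t = cosC (t / 2) * cosC (t / 2) + isinC (t / 2) * isinC (t / 2)
  /\ isinC t = cosC (t / 2) * isinC (t / 2) * 2.
Proof.
have {1 6}-> : t = t / 2 + t / 2 by lra.
rewrite /cosC /isinC cosD sinD ?mulr_natr ?mulr2n; split; apply/eqP; rewrite eq_complex /=.
  by apply/andP; split; apply/eqP; ring.
by apply/andP; split; apply/eqP; ring.
Qed.

Lemma num_pihalf_shift n t (X : 'M[C]_n) :
  rot_den (t + pi / 2) X = 'i *: rot_num t X /\ rot_num (t + pi / 2) X = 'i *: rot_den t X.
Proof.
rewrite /rot_den /rot_num /moebius_den /moebius_num /cosC /isinC cosDpihalf sinDpihalf.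
have -> : (- sin t)%:C = 'i * (0 +i* sin t) :> C by simpc.
have -> : 0 +i* cos t = 'i * (cos t)%:C :> C by simpc.
by split; apply/matrixP => i j; rewrite !mxE; ring.
Qed.

Lemma i_neq0 : 'i != 0 :> C.
Proof. by rewrite eq_complex /= eqxx oner_eq0. Qed.

Lemma axis_free_num n t (X : 'M[C]_n) : axis_free X -> rot_num t X \in unitmx.
Proof.
move=> uX; have := uX (t + pi / 2); rewrite (num_pihalf_shift t X).1.
by rewrite unitmxZ // unitfE i_neq0.
Qed.

Lemma rot_pihalf_shift n t (X : 'M[C]_n) : axis_free X ->
  rotm (t + pi / 2) X *m rot_num t X = rot_den t X.
Proof.
move=> uX; have := rotK (t + pi / 2) uX.
rewrite (num_pihalf_shift t X).1 (num_pihalf_shift t X).2 -scalemxAr.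
by move/(scalerI i_neq0).
Qed.

(** The denominator factors like sinh 2z = 2 sinh z cosh z. *)
Lemma den_newton n t (X : 'M[C]_n) : X \in unitmx ->
  rot_den t (newton X) = rot_num (t / 2) X *m rot_den (t / 2) X *m invmx X.
Proof.
move=> uX; rewrite mul_num_den /rot_den /newton /moebius_den.
have [-> ->] := half_angles t.
move: (cosC (t / 2)) (isinC (t / 2)) => c w.
rewrite !mulmxDl -!scalemxAl mul_scalar_mx (mulmxV uX) (mulmxK uX).
rewrite -[(c * c + w * w)%:M]scalemx1; apply/matrixP => i j; rewrite !mxE.
by move: (invmx X i j) (X i j) ((i == j)%:R : C) => y x e; field.
Qed.

Lemma axis_free_newton n (X : 'M[C]_n) : axis_free X -> axis_free (newton X).
Proof.
move=> uX t; have uX' := axis_free_unitmx uX.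
rewrite (den_newton t uX'); move: (axis_free_num (t / 2) uX) (uX (t / 2)).
by move: (rot_num _ _) (rot_den _ _) => W D uW uD; rewrite !unitmx_mul unitmx_inv uX' uW uD.
Qed.

Lemma sqr_num_sqr_den n t (X : 'M[C]_n) :
  rot_num t X *m rot_num t X + rot_den t X *m rot_den t X =
  (cosC t * cosC t + isinC t * isinC t) *: (X *m X + 1%:M)
  + (4 * (cosC t * isinC t)) *: X.
Proof.
rewrite /rot_num /rot_den /moebius_num /moebius_den; move: (cosC t) (isinC t) => c w.
rewrite !mulmxDl !mulmxDr -!scalemxAl !mul_scalar_mx -!scalemxAr !mul_mx_scalar.
move: (X *m X) => Y; rewrite -[w%:M]scalemx1 -[c%:M]scalemx1.
apply/matrixP => i j; rewrite !mxE.
by move: (Y i j) (X i j) ((i == j)%:R : C) => y x e; ring.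
Qed.

(** The identity coth 2z = (coth z + tanh z) / 2 at z = w + i t / 2, where
    tanh z = coth (z + i pi / 2). *)
Lemma rot_newton n t (X : 'M[C]_n) : axis_free X ->
  rotm t (newton X) = 2^-1 *: (rotm (t / 2) X + rotm (t / 2 + pi / 2) X).
Proof.
move=> uX; apply/esym/rot_uniq; first exact: axis_free_newton.
have uX' := axis_free_unitmx uX.
have E (W D r1 r2 : 'M[C]_n) : r1 *m D = W -> r2 *m W = D -> D *m W = W *m D ->
    (r1 + r2) *m (W *m D) = W *m W + D *m D.
  by move=> e1 e2 DW; rewrite mulmxDl -{1}DW !mulmxA e1 e2.
rewrite (den_newton t uX') mulmxA -scalemxAl.
rewrite (E _ _ _ _ (rotK (t / 2) uX) (rot_pihalf_shift (t / 2) uX) (den_numC _ _)).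
rewrite sqr_num_sqr_den.
rewrite /rot_num /newton /moebius_num; have [-> ->] := half_angles t.
move: (cosC (t / 2)) (isinC (t / 2)) => c w.
rewrite -scalemxAl mulmxDl -!scalemxAl mulmxDl mul1mx (mulmxV uX') (mulmxK uX').
rewrite -[(c * w * 2)%:M]scalemx1; apply/matrixP => i j; rewrite !mxE.
by move: (invmx X i j) (X i j) ((i == j)%:R : C) => y x e; field.
Qed.

Lemma opnorm_half_sum n (X Y : 'M[C]_n) (b : R) :
  opnorm X <= b -> opnorm Y <= b -> opnorm (2^-1 *: (X + Y)) <= b.
Proof.
move=> hX hY; have -> : b = 2^-1 * (b + b) by field.
apply: opnormZ_le; last exact: opnormD_le.
by rewrite normc_half.
Qed.

Lemma rot_bounded_newton n B (X : 'M[C]_n) : axis_free X ->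
  rot_bounded B X -> rot_bounded B (newton X).
Proof. by move=> uX bX t; rewrite rot_newton // opnorm_half_sum. Qed.

Lemma rot_near_newton n e (X Y : 'M[C]_n) : axis_free X -> axis_free Y ->
  rot_near e X Y -> rot_near e (newton X) (newton Y).
Proof.
move=> uX uY nXY t; rewrite !rot_newton // -scalerBr opprD addrACA.
exact: opnorm_half_sum.
Qed.

Definition rot_lipschitz n (M : R) (X : 'M[C]_n) :=
  forall t s, opnorm (rotm t X - rotm s X) <= M * `|t - s|.

(** Each Newton step halves the angles, hence the Lipschitz constant. *)
Lemma rot_lipschitz_newton n M (X : 'M[C]_n) : axis_free X ->
  rot_lipschitz M X -> rot_lipschitz (M / 2) (newton X).
Proof.
move=> uX lX t s; rewrite !rot_newton // -scalerBr opprD addrACA.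
have E : `|t / 2 - s / 2| = `|t - s| / 2.
  by rewrite -mulrBl normrM [`|2^-1|]ger0_norm.
apply: opnorm_half_sum.
  by have := lX (t / 2) (s / 2); rewrite E mulrA mulrAC.
have := lX (t / 2 + pi / 2) (s / 2 + pi / 2).
have -> : t / 2 + pi / 2 - (s / 2 + pi / 2) = t / 2 - s / 2 by ring.
by rewrite E mulrA mulrAC.
Qed.

Lemma moebius_cosh n (c w : C) (X : 'M[C]_n) :
  c *: moebius_den c w X - w *: moebius_num c w X = (c * c - w * w)%:M.
Proof.
rewrite /moebius_den /moebius_num -[c%:M]scalemx1 -[w%:M]scalemx1 -[RHS]scalemx1.
apply/matrixP => i j; rewrite !mxE.
by move: (X i j) ((i == j)%:R : C) => x e; ring.
Qed.

(** The denominator is sinh (w + i t) / sinh w; this controls its inverse by the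
    rotations themselves. *)
Lemma invmx_den n t (X : 'M[C]_n) : axis_free X ->
  invmx (rot_den t X) = (cosC t)%:M - isinC t *: rotm t X.
Proof.
move=> uX; apply: (can_inj (mulmxK (uX t))).
rewrite (mulVmx (uX t)) mulmxBl mul_scalar_mx -scalemxAl (rotK t uX).
by rewrite moebius_cosh cosC2_isinC2.
Qed.

Lemma opnorm_invmx_den n t B (X : 'M[C]_n) : axis_free X -> rot_bounded B X ->
  opnorm (invmx (rot_den t X)) <= 1 + B.
Proof.
move=> uX bX; rewrite invmx_den //; apply: opnormB_le.
  exact: le_trans (opnorm_scalar _ _) (normc_cosC t).
by rewrite -[B]mul1r; apply: opnormZ_le; [apply: normc_isinC|apply: bX].
Qed.

(** The matrix form of
    coth a - coth b = sinh (b - a) / (sinh a sinh b). *)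
Lemma den_rotB_den n t s (X Y : 'M[C]_n) : axis_free X -> axis_free Y ->
  rot_den t X *m (rotm s Y - rotm t X) *m rot_den s Y =
  (cosC t * cosC s - isinC t * isinC s) *: (Y - X)
  + (cosC t * isinC s - isinC t * cosC s) *: (1%:M - X *m Y).
Proof.
move=> uX uY.
have E (D D' r r' W W' : 'M[C]_n) : D *m r = W -> r' *m D' = W' ->
    D *m (r' - r) *m D' = D *m W' - W *m D'.
  by move=> <- <-; rewrite mulmxBr mulmxBl mulmxA.
rewrite (E _ _ _ _ _ _ (den_rot t uX) (rotK s uY)) {E}.
rewrite mul_den_num mul_num_den.
rewrite -[(cosC t * isinC s)%:M]scalemx1 -[(isinC t * cosC s)%:M]scalemx1.
move: (X *m Y) (cosC t) (isinC t) (cosC s) (isinC s) => Z c w c' w'.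
apply/matrixP => i j; rewrite !mxE.
by move: (X i j) (Y i j) (Z i j) ((i == j)%:R : C) => x y z e; ring.
Qed.

Lemma rotB n t s (X Y : 'M[C]_n) : axis_free X -> axis_free Y ->
  rotm s Y - rotm t X = invmx (rot_den t X) *m
   ((cosC t * cosC s - isinC t * isinC s) *: (Y - X)
  + (cosC t * isinC s - isinC t * cosC s) *: (1%:M - X *m Y)) *m invmx (rot_den s Y).
Proof. by move=> uX uY; rewrite -(den_rotB_den t s uX uY) -mulmxA (mulmxK (uY s)) (mulKmx (uX t)). Qed.

Lemma rotB_same_angle n t (X Y : 'M[C]_n) : axis_free X -> axis_free Y ->
  rotm t Y - rotm t X = invmx (rot_den t X) *m (Y - X) *m invmx (rot_den t Y).
Proof.
move=> uX uY; rewrite (rotB t t uX uY) cosC2_isinC2 scale1r.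
by rewrite [cosC t * isinC t]mulrC subrr scale0r addr0.
Qed.

(** By the addition formula, X_t changes by D^-1 E D'^-1, where D and D' are the
    denominators before and after. *)
Lemma axis_free_perturb n B (X E : 'M[C]_n) : axis_free X -> rot_bounded B X ->
  opnorm E * (1 + B) <= 1 / 2 ->
  axis_free (X + E) /\ rot_near (2 * (1 + B) ^+ 2 * opnorm E) (X + E) X.
Proof.
move=> uX bX hE.
have B0 : 0 <= B := le_trans (opnorm_ge0 _) (bX 0).
have B1 : 0 < 1 + B by lra.
have key t : rot_den t (X + E) \in unitmx /\ opnorm (invmx (rot_den t (X + E))) <= 2 * (1 + B).
  have m0 : 0 < (2 * (1 + B))^-1 by rewrite invr_gt0; lra.
  have [x|-> h] := @expanding_unitmx _ _ (rot_den t (X + E)) (2 * (1 + B))^-1 m0; last first.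
    by rewrite invrK in h.
  have -> : rot_den t (X + E) = rot_den t X + isinC t *: E.
    by rewrite /rot_den /moebius_den scalerDr addrA.
  rewrite mulmxDl; set p := _ *m x; set q := _ *m x.
  have hp : l2norm x <= (1 + B) * l2norm p.
    apply: le_trans (unitmx_expanding x (uX t)) _.
    by rewrite ler_wpM2r ?l2norm_ge0 // opnorm_invmx_den.
  have hq : (1 + B) * l2norm q <= 1 / 2 * l2norm x.
    rewrite /q -scalemxAl l2normZ.
    apply: (@le_trans _ _ ((1 + B) * (opnorm E * l2norm x))).
      rewrite ler_pM2l //; apply: le_trans (l2norm_mulmx E x).
      by rewrite ler_piMl ?l2norm_ge0 // normc_isinC.
    by rewrite mulrA [(1 + B) * _]mulrC ler_wpM2r ?l2norm_ge0.
  have hpq : l2norm p <= l2norm (p + q) + l2norm q.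
    by rewrite -[l2norm q]l2normN -{1}[p](addrK q) l2normD.
  have h : (1 + B) * l2norm p <= (1 + B) * (l2norm (p + q) + l2norm q).
    by rewrite ler_pM2l.
  rewrite ler_pdivrMl; last by abstract_norms; lra.
  by move: h; rewrite mulrDr; abstract_norms; lra.
have uXE : axis_free (X + E) by move=> t; case: (key t).
split=> // t; rewrite (rotB_same_angle t uX uXE).
have -> : X + E - X = E by rewrite addrAC subrr add0r.
have -> : 2 * (1 + B) ^+ 2 * opnorm E = ((1 + B) * opnorm E) * (2 * (1 + B)) by ring.
apply: opnormM_le; last by case: (key t).
by apply: opnormM_le => //; apply: opnorm_invmx_den.
Qed.

Lemma rot_lipschitz_bounded n B (X : 'M[C]_n) : axis_free X -> rot_bounded B X ->
  rot_lipschitz ((1 + B ^+ 2) * (1 + B) ^+ 2) X.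
Proof.
move=> uX bX s t.
have B0 : 0 <= B := le_trans (opnorm_ge0 _) (bX 0).
rewrite (rotB t s uX uX) [X - X]subrr scaler0 add0r.
have -> : cosC t * isinC s - isinC t * cosC s = 0 +i* sin (s - t).
  rewrite /cosC /isinC sinB; simpc.
  by apply/eqP; rewrite eq_complex /=; apply/andP; split; apply/eqP; ring.
have -> : (1 + B ^+ 2) * (1 + B) ^+ 2 * `|s - t| =
  ((1 + B) * (`|s - t| * (1 + B * B))) * (1 + B) by ring.
have bX0 : opnorm X <= B by have := bX 0; rewrite rotm0.
apply: opnormM_le; last exact: opnorm_invmx_den.
apply: opnormM_le; first exact: opnorm_invmx_den.
apply: opnormZ_le; first by rewrite normc_imag norm_sin_le.
by apply: opnormB_le; [apply: opnorm1_le|apply: opnormM_le].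
Qed.

End Rotation.

(** * Bounded rotations from the condition number of the sign *)

Section InitialBound.
Variable R : realType.
Local Notation C := R[i].

Lemma opnorm1_ge n : (0 < n)%N -> 1 <= opnorm (1%:M : 'M[C]_n).
Proof.
move=> n0; have := normc_entry (1%:M : 'M[C]_n) (Ordinal n0) (Ordinal n0).
by rewrite mxE eqxx normc1.
Qed.

(** Since ||A|| <= 1, the resolvent at 0 has norm at least 1, so an admissible
    epsilon is at most 1 and 1 / epsilon <= 1 / epsilon ^ 2. *)
Lemma resolvent_on_axis n (A : 'M[C]_n) (K : R) :
  (0 < n)%N -> opnorm A <= 1 -> (kappa_sign A <= K%:E)%E ->
  1 <= K /\ forall y : R, (0 +i* y)%:M - A \in unitmx /\
     opnorm (invmx ((0 +i* y)%:M - A)) <= K.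
Proof.
move=> n0 A1 kK.
have main (e : R) : 0 < e -> exists2 x, 1 <= x < K + e & forall y : R,
    (0 +i* y)%:M - A \in unitmx /\ opnorm (invmx ((0 +i* y)%:M - A)) <= x.
  move=> e0; have : (kappa_sign A < (K + e)%:E)%E.
    by apply: le_lt_trans kK _; rewrite lte_fin ltrDl.
  move=> /ereal_inf_lt [_ [eps /= [eps0 avoid] <-]]; rewrite lte_fin => lte.
  have res y : (0 +i* y)%:M - A \in unitmx /\
      opnorm (invmx ((0 +i* y)%:M - A)) <= 1 / eps.
    have : ~ pseudospectrum eps A (0 +i* y).
      move=> h; suff : (pseudospectrum eps A `&` @imaginary_axis R)%classic (0 +i* y).
        by rewrite avoid.
      by split.
    rewrite /pseudospectrum /= => /not_orP [/negP]; rewrite negbK => ? /negP.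
    by rewrite -leNgt.
  have eps1 : 1 <= 1 / eps.
    have [uA hA] := res 0; move: uA hA; set D := _ - A => uA hA.
    have DN : opnorm D <= 1.
      rewrite /D -[0 +i* 0]/(0 : C).
      have -> : (0 : C)%:M - A = - A.
        by rewrite -scalemx1 scale0r add0r.
      by rewrite opnormN.
    apply: le_trans hA; apply: le_trans (opnorm1_ge n0) _.
    rewrite -(mulmxV uA) -[opnorm (invmx D)]mul1r.
    exact: opnormM_le.
  have eps2 : 1 / eps ^+ 2 = (1 / eps) ^+ 2 by rewrite !div1r exprVn.
  exists (1 / eps) => //; rewrite eps1 /=; apply: le_lt_trans lte.
  by rewrite eps2 expr2 ler_peMl //; lra.
split; first by apply/ler_addgt0Pr => e /main [x /andP[x1 xK] _]; lra.
move=> y; split; first by have [x _ /(_ y) []] := main 1 ltr01.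
apply/ler_addgt0Pr => e /main [x /andP[_ xK] /(_ y) [_ h]].
exact: le_trans h (ltW xK).
Qed.

(** When |sin t| <= 1/2 the term cos t dominates the denominator of the rotation,
    as ||A|| <= 1; otherwise the denominator is a multiple, by at least 1/2, of
    the resolvent's argument i cot t - A. *)
Lemma initial_rot_bounded n (A : 'M[C]_n) (K : R) :
  (0 < n)%N -> opnorm A <= 1 -> (kappa_sign A <= K%:E)%E ->
  [/\ 1 <= K, axis_free A & rot_bounded (5 * K) A].
Proof.
move=> n0 A1 kK; have [K1 res] := resolvent_on_axis n0 A1 kK.
have cs (t : R) : cos t ^+ 2 + sin t ^+ 2 = 1 by exact: cos2Dsin2.
have Ax x : l2norm (A *m x) <= l2norm x.
  by apply: le_trans (l2norm_mulmx _ _) _; rewrite ler_piMl ?l2norm_ge0.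
have numle (t : R) : opnorm (rot_num t A) <= `|sin t| + `|cos t|.
  rewrite /rot_num /moebius_num; apply: opnormD_le.
    by apply: le_trans (opnorm_scalar _ _) _; rewrite normc_imag.
  by rewrite -[`|cos t|]mulr1; apply: opnormZ_le => //; rewrite normc_real.
have key (t : R) : rot_den t A \in unitmx /\ opnorm (rotm t A) <= 5 * K.
  have [s12|s12] := leP `|sin t| (1 / 2).
    have [uD hD] : rot_den t A \in unitmx /\ opnorm (invmx (rot_den t A)) <= (3^-1)^-1.
      apply: expanding_unitmx; first by rewrite invr_gt0.
      move=> x; rewrite /rot_den /moebius_den mulmxDl mul_scalar_mx -scalemxAl.
      set p := _ *: x; set q := _ *: (A *m x).
      have hp : l2norm p = `|cos t| * l2norm x by rewrite l2normZ normc_real.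
      have hq : l2norm q <= 1 / 2 * l2norm x.
        rewrite l2normZ normc_imag ler_pM ?l2norm_ge0 //.
      have hpq : l2norm p <= l2norm (p + q) + l2norm q.
        by rewrite -[l2norm q]l2normN -{1}[p](addrK q) l2normD.
      have hc : 5 / 6 <= `|cos t|.
        have := cs t; rewrite -[cos t ^+ 2]real_normK ?num_real //.
        rewrite -[sin t ^+ 2]real_normK ?num_real // => E.
        have := normr_ge0 (sin t); have := normr_ge0 (cos t).
        by move=> ? ?; rewrite leNgt; apply/negP => ?; nra.
      have : 5 / 6 * l2norm x <= l2norm p by rewrite hp ler_wpM2r ?l2norm_ge0.
      move=> hcp; apply: (@le_trans _ _ (l2norm p - l2norm q)); last by rewrite lerBlDr.
      by have := l2norm_ge0 x; abstract_norms; lra.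
    split=> //; rewrite /rotm; apply: le_trans (opnormM _ _) _.
    rewrite invrK in hD; have hn := numle t; have := normr_ge0 (sin t).
    have : `|cos t| <= 1 by exact: cos_max.
    have := opnorm_ge0 (rot_num t A); have := opnorm_ge0 (invmx (rot_den t A)).
    by move: hn hD; abstract_norms; nra.
  set y := cos t / sin t.
  have s0 : sin t != 0.
    by apply/eqP => s0; move: s12; rewrite s0 normr0; lra.
  have [uz hz] := res y.
  have E : rot_den t A = (0 +i* - sin t) *: ((0 +i* y)%:M - A).
    rewrite /rot_den /moebius_den scalerBr -[(0 +i* y)%:M]scalemx1 scalerA.
    have -> : (0 +i* - sin t) * (0 +i* y) = cosC t.
      apply/eqP; rewrite eq_complex /=; apply/andP; split; apply/eqP; last by ring.
      by rewrite /y; field.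
    rewrite scalemx1; congr (_ + _); rewrite -scaleNr; congr (_ *: _).
    by apply/eqP; rewrite eq_complex /=; apply/andP; split; apply/eqP; ring.
  have [uD hD] : rot_den t A \in unitmx /\ opnorm (invmx (rot_den t A)) <= ((2 * K)^-1)^-1.
    apply: expanding_unitmx; first by rewrite invr_gt0 mulr_gt0 // (lt_le_trans ltr01).
    move=> x; rewrite E -scalemxAl l2normZ normc_imag normrN.
    have := unitmx_expanding x uz; set a := l2norm (_ *m x) => ha.
    rewrite ler_pdivrMl; last by abstract_norms; lra.
    have a0 : 0 <= a by exact: l2norm_ge0.
    have h1 : l2norm x <= K * a by apply: le_trans ha _; rewrite ler_wpM2r.
    apply: le_trans h1 _; have K0 : 0 <= K := le_trans ler01 K1.
    have -> : 2 * K * (`|sin t| * a) = K * a * (2 * `|sin t|) by ring.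
    by rewrite ler_peMr ?mulr_ge0 //; clear -s12; lra.
  split=> //; rewrite /rotm; apply: le_trans (opnormM _ _) _.
  rewrite invrK in hD; have hn := numle t.
  have : `|cos t| <= 1 by exact: cos_max.
  have : `|sin t| <= 1 by exact: sin_max.
  have := opnorm_ge0 (rot_num t A); have := opnorm_ge0 (invmx (rot_den t A)).
  by move: hn hD; abstract_norms; nra.
by split=> // t; case: (key t).
Qed.
End InitialBound.

(** * Spectra in the right half plane and the sign function *)

Section RightHalf.
Variable R : realType.
Local Notation C := R[i].

Definition right_half n (M : 'M[C]_n) := forall z, eigenvalue M z -> 0 < Re z.

Lemma right_half_unitmx n (M : 'M[C]_n) : right_half M -> M \in unitmx.
Proof.
move=> rM; rewrite -row_free_unit -kermx_eq0; apply/negPn/negP => k0.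
have := rM 0; rewrite /eigenvalue /eigenspace -scalemx1 scale0r subr0 => /(_ k0).
by rewrite ltxx.
Qed.

Lemma Re_inv_gt0 (r : C) : 0 < Re r -> 0 < Re r^-1.
Proof.
case: r => a b /= a0; rewrite divr_gt0 //.
by rewrite ltr_wpDr ?sqr_ge0 // exprn_gt0.
Qed.

(** If z is an eigenvalue of the Newton iterate of M, then one of the two numbers
    r with (r + 1/r) / 2 = z is an eigenvalue of M, and Re r and Re (1/r) have
    the same sign. *)
Lemma right_half_newton n (M : 'M[C]_n) : right_half M -> right_half (newton M).
Proof.
move=> rM z /eigenvalueP [v vz v0].
have uM := right_half_unitmx rM.
set d := sqrtc (z ^+ 2 - 1).
have d2 : d ^+ 2 = z ^+ 2 - 1 by exact: sqr_sqrtc.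
have r12 : (z + d) * (z - d) = 1.
  have -> : (z + d) * (z - d) = z ^+ 2 - d ^+ 2 by ring.
  by rewrite d2; ring.
have E : (v *m (M - (z + d)%:M)) *m (M - (z - d)%:M) = 0.
  have h : v *m (M *m M + 1%:M) = (2 * z) *: (v *m M).
    have -> : M *m M + 1%:M = 2 *: (newton M *m M).
      by rewrite /newton -scalemxAl scalerA divff ?pnatr_eq0 // scale1r mulmxDl mulVmx.
    by rewrite -scalemxAr mulmxA vz -scalemxAl scalerA.
  rewrite -mulmxA mulmxBl !mulmxBr mul_scalar_mx mul_mx_scalar mul_scalar_mx.
  rewrite scale_scalar_mx r12.
  have -> : v *m (M *m M) = (2 * z) *: (v *m M) - v by rewrite -h mulmxDr mulmx1 addrK.
  rewrite -!scalemxAr mulmx1.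
  by apply/matrixP => i j; rewrite !mxE; ring.
have pos (r : C) : 0 < Re r -> r * (z + z - r) = 1 -> 0 < Re z.
  move=> r0 rz; have rn0 : r != 0 by apply/eqP => h; move: r0; rewrite h ltxx.
  have : Re (z + z - r) = Re r^-1.
    by congr Re; apply: (mulfI rn0); rewrite rz divff.
  by have := Re_inv_gt0 r0; move: r0; case: (z) (r) (r^-1) => a b [c e] [f g] /=; lra.
have [w0|w0] := eqVneq (v *m (M - (z + d)%:M)) 0.
  apply: (pos (z + d)); last by rewrite -r12; ring.
  apply: rM; apply/eigenvalueP; exists v => //.
  by move/eqP: w0; rewrite mulmxBr mul_mx_scalar subr_eq0 => /eqP.
apply: (pos (z - d)); last by rewrite -r12; ring.
apply: rM; apply/eigenvalueP; exists (v *m (M - (z + d)%:M)) => //.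
by move/eqP: E; rewrite mulmxBr mul_mx_scalar subr_eq0 => /eqP.
Qed.

Lemma horner_char_poly n (M : 'M[C]_n) (a : C) : (char_poly M).[a] = \det (a%:M - M).
Proof.
rewrite -[LHS]/(horner_eval a (char_poly M)) -det_map_mx; congr (\det _).
apply/matrixP => i j; rewrite !mxE /= -[LHS]/(('X *+ (i == j) - (M i j)%:P).[a]).
by rewrite !hornerE hornerMn hornerX.
Qed.

(** The determinant is the product of the 1 + r over the eigenvalues r, and
    Re (1 + r) > 1. *)
Lemma right_half_det n (M : 'M[C]_n) : right_half M -> 1 <= normc (\det (M + 1%:M)).
Proof.
move=> rM.
have -> : M + 1%:M = - ((-1)%:M - M).
  by apply/matrixP => i j; rewrite !mxE; case: (i == j) => /=; rewrite ?mulr1n ?mulr0n; ring.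
rewrite -scaleN1r detZ normcM -horner_char_poly.
have -> : normc ((-1) ^+ n : C) = 1.
  by elim: n {M rM} => [|n IH]; rewrite ?expr0 ?normc1 // exprS normcM IH normcN normc1 mulr1.
rewrite mul1r.
have [r Er] := closed_field_poly_normal (char_poly M).
have rr z : z \in r -> 0 < Re z.
  move=> zr; apply: rM; rewrite eigenvalue_root_char Er.
  rewrite rootZ ?root_prod_XsubC //.
  by rewrite lead_coef_eq0 monic_neq0 // char_poly_monic.
rewrite Er (monicP (char_poly_monic M)) scale1r horner_prod.
elim: r {Er} rr => [|z r IH] rr; first by rewrite big_nil normc1.
rewrite big_cons normcM -[leLHS]mulr1 ler_pM //; last first.
  by apply: IH => x xr; apply: rr; rewrite inE xr orbT.
rewrite hornerXsubC -normcN opprB opprK.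
have z0 := rr z (mem_head _ _).
apply: le_trans (ler_Re_normc _); apply: le_trans (ler_norm _).
by move: z0; case: (z) => x y /=; lra.
Qed.

Lemma normc_prod (I : finType) (f : I -> C) : normc (\prod_i f i) = \prod_i normc (f i).
Proof.
by elim/big_rec2: _ => [|i y x _ <-]; rewrite ?normc1 // normcM.
Qed.

Lemma normc_det n (M : 'M[C]_n) b : (forall i j, normc (M i j) <= b) ->
  normc (\det M) <= #|{: {perm 'I_n}}|%:R * b ^+ n.
Proof.
move=> Mb; rewrite /determinant; apply: le_trans (normc_sum _) _.
rewrite mulr_natl -sumr_const; apply: ler_sum => s _.
rewrite normcM normc_prod.
have -> : normc ((-1) ^+ s : C) = 1.
  by case: (odd_perm s); rewrite ?expr0 ?expr1 ?normcN normc1.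
rewrite mul1r -[n in b ^+ n]card_ord -prodr_const.
by apply: ler_prod => i _; rewrite normc_ge0 Mb.
Qed.

(** Cramer's rule bounds the inverse in terms of the norm alone, uniformly in
    M; the bound is huge, but it is only used to identify a limit. *)
Lemma right_half_inv_bound n (b : R) : exists H : R, 0 <= H /\
  forall M : 'M[C]_n, right_half M -> opnorm M <= b ->
  M + 1%:M \in unitmx /\ opnorm (invmx (M + 1%:M)) <= H.
Proof.
have [b0|b0] := ltP b 0.
  exists 0; split=> // M _ h; have := le_trans (opnorm_ge0 M) h.
  by rewrite leNgt b0.
set H := #|{: {perm 'I_(n.-1)}}|%:R * (b + 1) ^+ n.-1.
have H0 : 0 <= H by rewrite mulr_ge0 // exprn_ge0 // addr_ge0.
exists (n%:R * H); split; first by rewrite mulr_ge0.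
move=> M rM Mb; have dM := right_half_det rM.
have uM : M + 1%:M \in unitmx.
  rewrite unitmxE unitfE; apply/eqP => d0; move: dM; rewrite d0 normc0.
  by rewrite ler10.
split=> //; apply: opnorm_entries => // i j.
have eb k l : normc ((M + 1%:M) k l) <= b + 1.
  apply: le_trans (normc_entry _ _ _) _.
  by apply: opnormD_le => //; apply: opnorm1_le.
rewrite /invmx uM !mxE normcM normcV.
rewrite -[leRHS]mul1r ler_pM ?invr_ge0 ?normc_ge0 //.
  by rewrite invf_le1 // (lt_le_trans ltr01).
rewrite /cofactor normcM.
have -> : normc ((-1) ^+ (j + i) : C) = 1.
  by elim: (j + i)%N => [|m IH]; rewrite ?expr0 ?normc1 // exprS normcM IH normcN normc1 mulr1.
rewrite mul1r; apply: normc_det => k l.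
by rewrite !mxE; have := eb (lift j k) (lift i l); rewrite !mxE.
Qed.
End RightHalf.

Section Sign.
Variable R : realType.
Local Notation C := R[i].

Lemma is_sgnP n (A S : 'M[C]_n) : is_sgn A S ->
  [/\ S *m S = 1%:M, A *m S = S *m A & right_half (A *m S)].
Proof.
case=> p [q [e [V [N [P [uV _ [hN hP] -> ->]]]]]].
case: _ / e; rewrite !castmx_id.
set D := block_mx N 0 0 P; set E := block_mx (- 1%:M) 0 0 1%:M.
have EE : E *m E = 1%:M.
  rewrite mulmx_block !(mulmx0, mul0mx, addr0, add0r) mulmxN mulNmx opprK !mulmx1.
  by rewrite -scalar_mx_block.
have DE : D *m E = block_mx (- N) 0 0 P.
  by rewrite mulmx_block !(mulmx0, mul0mx, addr0, add0r) mulmxN !mulmx1.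
have ED : E *m D = block_mx (- N) 0 0 P.
  by rewrite mulmx_block !(mulmx0, mul0mx, addr0, add0r) mulNmx !mul1mx.
have conj X Y : V *m X *m invmx V *m (V *m Y *m invmx V) = V *m (X *m Y) *m invmx V.
  by rewrite !mulmxA mulmxKV.
split; rewrite ?conj.
- by rewrite EE mulmx1 mulmxV.
- by rewrite DE ED.
move=> z /eigenvalueP [v vz v0].
have wz : (v *m V) *m (D *m E) = z *: (v *m V).
  by rewrite scalemxAl -vz !mulmxA mulmxKV.
have w0 : v *m V != 0.
  by apply: contra v0 => /eqP h; rewrite -[v](mulmxK uV) h mul0mx.
move: (v *m V) w0 wz => w; rewrite -[w]hsubmxK DE.
set l := lsubmx w; set r := rsubmx w => w0.
rewrite mul_row_block !(mulmx0, addr0, add0r) scale_row_mx => /eq_row_mx [hl hr].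
have [l0|l0] := eqVneq l 0.
  have r0 : r != 0.
    by apply: contra w0 => /eqP ->; rewrite l0 row_mx0.
  by apply: hP; apply/eigenvalueP; exists r.
have : Re (- z) < 0.
  apply: hN; apply/eigenvalueP; exists l => //.
  by apply: oppr_inj; rewrite -mulmxN hl scaleNr opprK.
by case: (z) => x y /=; lra.
Qed.

(** The Newton map is odd and S acts as a sign commuting with X. *)
Lemma newton_mul_involution n (X S : 'M[C]_n) : X \in unitmx ->
  S *m S = 1%:M -> X *m S = S *m X ->
  newton X *m S = newton (X *m S) /\ newton X *m S = S *m newton X.
Proof.
move=> uX SS XS.
have VS : invmx X *m S = S *m invmx X.
  by rewrite -[LHS](mulmxK uX) -(mulmxA (invmx X)) -XS mulmxA mulVmx // mul1mx.
have VXS : invmx (X *m S) = invmx X *m S.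
  have uS : X *m S \in unitmx.
    rewrite unitmx_mul uX /=; by case: (mulmx1_unit SS).
  apply: (can_inj (mulKmx uS)); rewrite mulmxV // VS.
  by rewrite mulmxA -(mulmxA X) SS mulmx1 mulmxV.
rewrite /newton VXS -!scalemxAl -!scalemxAr mulmxDl mulmxDr XS VS; split=> //.
Qed.

End Sign.

(** * Convergence of the exact iteration *)

Section ExactIteration.
Variables (R : realType) (n : nat) (A : 'M[R[i]]_n) (B : R).
Hypotheses (B1 : 1 <= B) (Afree : axis_free A) (Abdd : rot_bounded B A).

Definition iterate k := iter k (@newton R n) A.

Lemma iterateS k : iterate k.+1 = newton (iterate k).
Proof. by []. Qed.

Lemma iterate_axis_free k : axis_free (iterate k).
Proof. by elim: k => [|k IH]; [exact: Afree|exact: axis_free_newton IH]. Qed.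

Lemma iterate_rot_bounded k : rot_bounded B (iterate k).
Proof.
by elim: k => [|k IH]; [exact: Abdd|exact: rot_bounded_newton (iterate_axis_free k) IH].
Qed.

Definition lip := (1 + B ^+ 2) * (1 + B) ^+ 2.

Lemma lip_ge0 : 0 <= lip.
Proof. by rewrite /lip mulr_ge0 ?sqr_ge0 // addr_ge0 ?sqr_ge0. Qed.

Lemma iterate_rot_lipschitz k : rot_lipschitz (lip / 2 ^+ k) (iterate k).
Proof.
elim: k => [|k IH]; first by rewrite expr0 divr1; exact: rot_lipschitz_bounded Afree Abdd.
by rewrite exprSr invfM mulrA; exact: rot_lipschitz_newton (iterate_axis_free k) IH.
Qed.

Lemma iterate_unitmx k : iterate k \in unitmx.
Proof. exact: axis_free_unitmx (iterate_axis_free k). Qed.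

Lemma opnorm_iterate k : opnorm (iterate k) <= B.
Proof. by have := iterate_rot_bounded k 0; rewrite rotm0. Qed.

Lemma opnorm_inv_iterate k : opnorm (invmx (iterate k)) <= B.
Proof.
by have := iterate_rot_bounded k (pi / 2); rewrite (rot_pihalf (iterate_axis_free k)).
Qed.

Lemma iterate_inv_diff k : opnorm (invmx (iterate k) - iterate k) <= 2 * (lip / 2 ^+ k).
Proof.
have := iterate_rot_lipschitz k (pi / 2) 0.
rewrite (rot_pihalf (iterate_axis_free k)) rotm0.
move=> h; apply: le_trans h _; rewrite mulrC ler_wpM2r ?divr_ge0 ?exprn_ge0 ?lip_ge0 //.
rewrite subr0 ger0_norm; first by have := pihalf_lt2 R; lra.
by have := pihalf_ge1 R; lra.
Qed.

Lemma iterate_step k : opnorm (iterate k - iterate k.+1) <= lip / 2 ^+ k.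
Proof.
have -> : iterate k - iterate k.+1 = (- 2^-1) *: (invmx (iterate k) - iterate k).
  rewrite iterateS /newton; move: (iterate k) => X; apply/matrixP => i j; rewrite !mxE.
  by move: (X i j) (invmx X i j) => x y; field.
have -> : lip / 2 ^+ k = 2^-1 * (2 * (lip / 2 ^+ k)) by field; rewrite expf_neq0.
apply: opnormZ_le; last exact: (iterate_inv_diff k).
by rewrite normcN normc_half.
Qed.

Lemma iterate_tail k j : opnorm (iterate k - iterate (k + j)) <= 2 * (lip / 2 ^+ k).
Proof.
suff : opnorm (iterate k - iterate (k + j)) <= 2 * (lip / 2 ^+ k) - 2 * (lip / 2 ^+ (k + j)).
  move=> h; apply: le_trans h _; rewrite gerBl mulr_ge0 // divr_ge0 ?lip_ge0 //.
elim: j => [|j IH]; first by rewrite addn0 !subrr opnorm0.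
rewrite addnS; apply: le_trans (opnorm_triangle (iterate (k + j)) _ _) _.
move: IH; have := iterate_step (k + j).
have -> : lip / 2 ^+ (k + j).+1 = lip / 2 ^+ (k + j) / 2.
  by rewrite exprSr invfM mulrA.
by abstract_norms; lra.
Qed.

Variable S : 'M[R[i]]_n.
Hypotheses (SS : S *m S = 1%:M) (AS : A *m S = S *m A) (ASr : right_half (A *m S)).

Lemma iterate_sgn k : iterate k *m S = S *m iterate k /\ right_half (iterate k *m S).
Proof.
elim: k => [|k [IH1 IH2]]; first by split; [exact: AS|exact: ASr].
have [h1 h2] := newton_mul_involution (iterate_unitmx k) SS IH1.
by rewrite iterateS; split; [exact: h2|rewrite h1; exact: right_half_newton IH2].
Qed.

Lemma iterate_sub_sgn_factor k :
  (iterate k *m S - 1%:M) *m (iterate k *m S + 1%:M) = (iterate k - invmx (iterate k)) *m iterate k.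
Proof.
have [c _] := iterate_sgn k.
rewrite mulmxBl !mulmxDr !mul1mx !mulmx1 mulmxBl (mulVmx (iterate_unitmx k)).
rewrite [_ *m S *m _]mulmxA -(mulmxA (iterate k) S) -c mulmxA -mulmxA SS mulmx1.
by rewrite opprD addrA addrK.
Qed.

(** With G the k-th iterate times S, G - 1 = (G^2 - 1) (G + 1)^-1. The constant
    is out of control: this only identifies the limit. *)
Lemma iterate_cvg : exists H : R, 0 <= H /\ forall k, opnorm (iterate k - S) <= H / 2 ^+ k.
Proof.
have [H [H0 hH]] := @right_half_inv_bound R n (B * opnorm S).
have Sn := opnorm_ge0 S.
exists (2 * lip * B * H * opnorm S); split.
  have B0 : 0 <= B := le_trans ler01 B1.
  by do 4 (apply: mulr_ge0 => //); apply: lip_ge0.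
move=> k; have [c r] := iterate_sgn k.
have nb : opnorm (iterate k *m S) <= B * opnorm S.
  by apply: opnormM_le => //; apply: opnorm_iterate.
have [u hu] := hH _ r nb.
have -> : iterate k - S = (iterate k - invmx (iterate k)) *m iterate k *m
    invmx (iterate k *m S + 1%:M) *m S.
  by rewrite -iterate_sub_sgn_factor (mulmxK u) mulmxBl -mulmxA SS mulmx1 mul1mx.
have -> : 2 * lip * B * H * opnorm S / 2 ^+ k = (2 * (lip / 2 ^+ k)) * B * H * opnorm S by ring.
do 3 (apply: opnormM_le => //); last exact: opnorm_iterate.
by rewrite -opnormN opprB; apply: iterate_inv_diff.
Qed.

(** The geometric bound on the steps controls the distance to the limit. *)
Lemma iterate_linear k : opnorm (iterate k - S) <= 2 * (lip / 2 ^+ k).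
Proof.
have [H [H0 hH]] := iterate_cvg.
apply/ler_addgt0Pr => e e0.
have [j hj] : exists j, H / 2 ^+ j <= e.
  exists (Num.truncn (H / e)).+1; rewrite ler_pdivrMr ?exprn_gt0 // mulrC -ler_pdivrMr //.
  have /truncn_itv /andP[_ h] : 0 <= H / e by rewrite divr_ge0 // ltW.
  apply: le_trans (ltW h) _; rewrite -natrX ler_nat.
  by apply: ltnW; apply: ltn_expl.
apply: le_trans (opnorm_triangle (iterate (k + j)) _ _) _.
apply: lerD; first exact: iterate_tail.
apply: le_trans (hH _) _; apply: le_trans hj.
by rewrite ler_wpM2l // lef_pV2 ?posrE ?exprn_gt0 // ler_weXn2l ?ler1n // leq_addl.
Qed.

(** As S^2 = 1 and S commutes with the iterate X,
    (X + X^-1) / 2 - S = X^-1 (X - S)^2 / 2. *)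
Lemma iterate_quadratic k :
  opnorm (iterate k.+1 - S) <= 2^-1 * B * opnorm (iterate k - S) ^+ 2.
Proof.
have [c _] := iterate_sgn k.
have u := iterate_unitmx k.
have -> : iterate k.+1 - S = 2^-1 *: (invmx (iterate k) *m ((iterate k - S) *m (iterate k - S))).
  rewrite iterateS /newton mulmxBl !mulmxBr SS -c !mulmxA (mulVmx u) mul1mx mul1mx mulmx1.
  move: (iterate k) => X; apply/matrixP => i j; rewrite !mxE.
  by move: (X i j) (invmx X i j) (S i j) => x y z; field.
rewrite -mulrA; apply: opnormZ_le; first by rewrite normc_half.
apply: opnormM_le; first exact: opnorm_inv_iterate.
by rewrite expr2; apply: opnormM.
Qed.

(** The condition on k0 makes B / 2 times the error at most 1/2, by the linear
    bound; each further step squares this quantity. *)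
Lemma iterate_accuracy k0 j :
  2 * (B * lip) <= 2 ^+ k0 ->
  opnorm (iterate (k0 + j) - S) <= 2 * (1 / 2) ^+ (2 ^ j).
Proof.
move=> hk0; have B1' := B1; have B0 : 0 < B by lra.
suff h : B / 2 * opnorm (iterate (k0 + j) - S) <= (1 / 2) ^+ (2 ^ j).
  have h' : 1 / 2 * opnorm (iterate (k0 + j) - S) <= (1 / 2) ^+ (2 ^ j).
    by apply: le_trans h; rewrite ler_wpM2r ?opnorm_ge0 //; lra.
  by clear h hk0; move: h'; abstract_norms; lra.
elim: j => [|j IH].
  rewrite addn0 expn0 expr1; have := iterate_linear k0.
  set x := opnorm _ => hx.
  have : B / 2 * x <= B / 2 * (2 * (lip / 2 ^+ k0)) by rewrite ler_pM2l; lra.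
  have : B * lip / 2 ^+ k0 <= 1 / 2 by rewrite ler_pdivrMr ?exprn_gt0 //; lra.
  by rewrite -mulrA; lra.
rewrite addnS expnSr exprM; have := iterate_quadratic (k0 + j).
set x := opnorm (iterate (k0 + j) - S); set y := opnorm _ => hy.
have x0 : 0 <= x by exact: opnorm_ge0.
have : B / 2 * y <= (B / 2 * x) ^+ 2.
  apply: (@le_trans _ _ (B / 2 * (2^-1 * B * x ^+ 2))); first by rewrite ler_pM2l; lra.
  by rewrite le_eqVlt; apply/orP; left; apply/eqP; field.
move=> h; apply: le_trans h _; apply: lerXn2r IH; rewrite nnegrE.
  by apply: mulr_ge0 => //; lra.
by apply: exprn_ge0; lra.
Qed.

End ExactIteration.

(** * Stability of the perturbed iteration *)

Section PerturbedIteration.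
Variables (R : realType) (n : nat) (A : 'M[R[i]]_n) (B : R).
Hypotheses (B1 : 1 <= B) (Afree : axis_free A) (Abdd : rot_bounded B A).
Variables (eta : R) (q : nat).
(** The largest change of a rotation when an error eta is added to a matrix whose
    rotations are bounded by 2 B. *)
Definition drift := 2 * (1 + 2 * B) ^+ 2 * eta.
Hypothesis drift_small : q.+1%:R * drift <= B.

Definition tracks k (Y : 'M[R[i]]_n) :=
  axis_free Y /\ rot_near (k.+1%:R * drift) Y (iterate A k).

Lemma rot_bounded_near e (X Y : 'M[R[i]]_n) :
  rot_bounded B X -> rot_near e Y X -> rot_bounded (B + e) Y.
Proof.
move=> bX nY t; have := nY t; have := bX t => h1 h2.
by rewrite -[rotm t Y](subrK (rotm t X)) addrC; apply: opnormD_le.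
Qed.

Hypothesis eta0 : 0 <= eta.

Lemma drift_ge0 : 0 <= drift.
Proof. by apply: mulr_ge0 => //; apply: mulr_ge0 => //; apply: sqr_ge0. Qed.

Lemma eta_small k : (k <= q)%N -> eta * (1 + 2 * B) <= 1 / 2 /\ k.+1%:R * drift <= B.
Proof.
move=> kq; have d0 := drift_ge0; have B1' := B1; have eta0' := eta0; split; last first.
  by apply: le_trans drift_small; rewrite ler_wpM2r // ler_nat.
have : drift <= B.
  apply: le_trans drift_small; rewrite -[leLHS]mul1r ler_wpM2r //.
  by rewrite ler1n.
have -> : drift = 2 * (1 + 2 * B) * (eta * (1 + 2 * B)) by rewrite /drift; ring.
set x := eta * _ => h; rewrite leNgt; apply/negP => x2; nra.
Qed.

Lemma tracks_rot_bounded k Y : (k <= q)%N -> tracks k Y -> rot_bounded (2 * B) Y.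
Proof.
move=> kq [uY nY] t; have [_ h] := eta_small kq.
by have := rot_bounded_near (iterate_rot_bounded Afree Abdd k) nY t; abstract_norms; lra.
Qed.

Lemma tracks0 Y : opnorm (Y - A) <= eta -> tracks 0 Y.
Proof.
move=> hY; have [h1 h2] := eta_small (leq0n q).
have -> : Y = A + (Y - A) by rewrite addrC subrK.
have [||u nr] := @axis_free_perturb R n (2 * B) A (Y - A) Afree.
  move=> t; apply: le_trans (Abdd t) _; have := B1; lra.
  by apply: le_trans h1; rewrite ler_wpM2r //; have := B1; lra.
split; [exact: u|move=> t]; apply: le_trans (nr t) _; rewrite mul1r /drift ler_wpM2l //.
by apply: mulr_ge0 => //; apply: sqr_ge0.
Qed.

(** The exact Newton map does not increase the distance to the exact iterate, and
    the error of the step adds one drift. *)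
Lemma tracks_step k Y Y' : (k < q)%N -> tracks k Y ->
  opnorm (Y' - newton Y) <= eta -> tracks k.+1 Y'.
Proof.
move=> kq tY hY; have bY := tracks_rot_bounded (ltnW kq) tY.
have [uY nY] := tY; have [h1 h2] := eta_small kq.
have uN := axis_free_newton uY.
have bN := rot_bounded_newton uY bY.
have -> : Y' = newton Y + (Y' - newton Y) by rewrite addrC subrK.
have [|u nr] := @axis_free_perturb R n (2 * B) (newton Y) (Y' - newton Y) uN bN.
  by apply: le_trans h1; rewrite ler_wpM2r //; have := B1; lra.
split; [exact: u|move=> t]; apply: le_trans (opnorm_triangle (rotm t (newton Y)) _ _) _.
have := rot_near_newton uY (iterate_axis_free Afree k) nY t.
have h3 : 2 * (1 + 2 * B) ^+ 2 * opnorm (Y' - newton Y) <= drift.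
  by rewrite /drift ler_wpM2l //; apply: mulr_ge0 => //; apply: sqr_ge0.
have -> : k.+2%:R * drift = drift + k.+1%:R * drift by rewrite [k.+2%:R]mulrS mulrDl mul1r.
move: (nr t) => g1 g2; apply: lerD; first exact: le_trans g1 h3.
exact: g2.
Qed.

Lemma tracks_near k Y : tracks k Y -> opnorm (Y - iterate A k) <= k.+1%:R * drift.
Proof. by case=> _ /(_ 0); rewrite !rotm0. Qed.

End PerturbedIteration.

(** * Executions: shifted error streams and provenance of values *)

Section Executions.
Variable R : realType.
Local Notation C := R[i].
Implicit Types (u : R) (d : nat -> C) (s : state R) (c : cmd).

Lemma arr_of_mxK n (M : 'M[C]_n) : mx_of_arr n (arr_of_mx M) = M.
Proof. by apply/matrixP => i j; rewrite mxE /arr_of_mx !valK. Qed.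

Lemma arr_of_mxE n (M : 'M[C]_n) i j : arr_of_mx M i j = 0 \/
  exists i' j' : 'I_n, arr_of_mx M i j = M i' j'.
Proof.
rewrite /arr_of_mx; case: insubP => [i' _ _|]; last by left.
by case: insubP => [j' _ _|]; [right; exists i', j'|left].
Qed.

Definition delay k s : state R := State (nvar s) (fmem s) (ops s + k).

Lemma neval_delay k s e : neval (delay k s) e = neval s e.
Proof. by elim: e => //= e1 -> e2 ->. Qed.

Lemma get_delay k s l : Defs.get (delay k s) l = Defs.get s l.
Proof. by case: l => a i j; rewrite /Defs.get !neval_delay. Qed.

Lemma put_delay k s l x : put (delay k s) l x = put s l x.
Proof. by case: l => a i j; rewrite /put !neval_delay. Qed.

Lemma feval_delay k s f : feval (delay k s) f = feval s f.
Proof.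
by case: f => [m n|l|l|[] l1 l2]; rewrite /feval ?neval_delay ?get_delay.
Qed.

Lemma teval_delay k s t : teval (delay k s) t = teval s t.
Proof. by case: t => a b; rewrite /teval ?neval_delay ?get_delay. Qed.

Lemma tick_delay k s t : tick (delay k s) t = delay k (tick s t).
Proof. by case: t. Qed.

(** Errors are indexed by the number of operations performed so far; a
    procedure called late meets a shifted stream of errors. *)
Lemma exec_delay u d k c s s' :
  exec u (fun i => d (i + k)%N) c s s' -> exec u d c (delay k s) (delay k s').
Proof.
elim=> {c s s'}.
- by move=> s; exact: exec_skip.
- by move=> c1 c2 s s1 s2 _ h1 _ h2; exact: exec_seq h1 h2.
- move=> x e s; have := exec_nset u d x e (delay k s).
  by rewrite neval_delay.
- move=> l f s x fx; have := @exec_fset _ u d l f (delay k s) x.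
  by rewrite feval_delay put_delay => /(_ fx).
- move=> l l1 s; have := exec_fcopy u d l l1 (delay k s).
  by rewrite get_delay put_delay.
- by move=> l s; have := exec_feps u d l (delay k s); rewrite put_delay.
- by move=> t c1 c2 s s' _ h; apply: exec_if; rewrite teval_delay tick_delay.
- move=> t c s tF; rewrite -tick_delay; apply: exec_while_false.
  by rewrite teval_delay.
- move=> t c s s1 s2 tT _ h1 _ h2; apply: exec_while_true h2.
    by rewrite teval_delay.
  by rewrite tick_delay.
- move=> c e a b s s' _ h; have := @exec_call _ u d c e a b (delay k s) (delay k s').
  by rewrite !neval_delay; apply.
Qed.

Definition traced u s (L : seq C) (x : C) :=
  [\/ x \in L, x = 0, x = u%:C | exists a i j, x = fmem s a i j].

Lemma put_cases s l x a i j :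
  put s l x a i j = x \/ put s l x a i j = fmem s a i j.
Proof.
case: l => a' i' j'; rewrite /put /upd.
case: eqP => [->|_]; last by right.
case: eqP => [->|_]; last by right.
by case: eqP => [->|_]; [left|right].
Qed.

Lemma traced_trans u s s1 L L1 x :
  (forall a i j, traced u s L (fmem s1 a i j)) -> traced u s1 L1 x ->
  traced u s (L1 ++ L) x.
Proof.
move=> h [xL|x0|xu|[a [i [j ->]]]].
- by apply: Or41; rewrite mem_cat xL.
- exact: Or42.
- exact: Or43.
- case: (h a i j) => [xL|x0|xu|xs].
  + by apply: Or41; rewrite mem_cat xL orbT.
  + exact: Or42.
  + exact: Or43.
  + exact: Or44.
Qed.

(** Only floating point operations create values: copies and calls move values
    around, calls pad with 0, and the machine precision is available for free. *)
Lemma exec_traced u d c s s' : exec u d c s s' ->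
  exists L : seq C, (size L + ops s <= ops s')%N /\
    forall a i j, traced u s L (fmem s' a i j).
Proof.
have tk s1 t : fmem (tick s1 t) = fmem s1 /\ (ops s1 <= ops (tick s1 t))%N.
  by case: t => [? ?|? ?] //=; split.
elim=> {c s s'}.
- by move=> s; exists [::]; split=> // a i j; apply: Or44; exists a, i, j.
- move=> c1 c2 s s1 s2 _ [L1 [z1 h1]] _ [L2 [z2 h2]].
  exists (L2 ++ L1); split; first by rewrite size_cat; lia.
  by move=> a i j; apply: traced_trans (h2 a i j).
- by move=> x e s; exists [::]; split=> // a i j; apply: Or44; exists a, i, j.
- move=> l f s x _; exists [:: x * (1 + d (ops s))]; split=> // a i j /=.
  have [->|->] := put_cases s l (x * (1 + d (ops s))) a i j.
    by apply: Or41; rewrite inE.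
  by apply: Or44; exists a, i, j.
- move=> l l1 s; exists [::]; split=> // a i j /=.
  have [->|->] := put_cases s l (Defs.get s l1) a i j; last by apply: Or44; exists a, i, j.
  by case: l1 => a1 i1 j1; apply: Or44; exists a1, (neval s i1), (neval s j1).
- move=> l s; exists [::]; split=> // a i j /=.
  have [->|->] := put_cases s l u%:C a i j; first exact: Or43.
  by apply: Or44; exists a, i, j.
- move=> t c1 c2 s s' _ [L [z h]]; have [e1 e2] := tk s t.
  exists L; split; first lia.
  by move=> a i j; have := h a i j; rewrite /traced e1.
- move=> t c s _; have [e1 e2] := tk s t.
  by exists [::]; split=> // a i j; rewrite e1; apply: Or44; exists a, i, j.
- move=> t c s s1 s2 _ _ [L1 [z1 h1]] _ [L2 [z2 h2]]; have [e1 e2] := tk s t.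
  exists (L2 ++ L1); split; first by rewrite size_cat; lia.
  move=> a i j; apply: traced_trans (h2 a i j) => a' i' j'.
  by have := h1 a' i' j'; rewrite /traced e1.
- move=> c e a b s s' _ [L [z h]]; exists L; split=> // a1 i j.
  rewrite /= {1}/upd; case: eqP => _; last by apply: Or44; exists a1, i, j.
  have [->|[i' [j' ->]]] := arr_of_mxE (mx_of_arr (neval s e) (fmem s' 0%N)) i j.
    exact: Or42.
  rewrite mxE; case: (h 0%N i' j') => [xL|x0|xu|].
  + exact: Or41.
  + exact: Or42.
  + exact: Or43.
  + case=> -[|a2] [i2 [j2 ->]] /=; last first.
      by rewrite nth_default //; exact: Or42.
    have [->|[i3 [j3 ->]]] := arr_of_mxE (mx_of_arr (neval s e) (fmem s a)) i2 j2.
      exact: Or42.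
    by rewrite mxE; apply: Or44; exists a, i3, j3.
Qed.

End Executions.

(** * A lower bound on the operations of stable inversion *)

Section OperationLowerBound.
Variable R : realType.
Local Notation C := R[i].

(** Its square is 0, so the inverse of 1 + block_upper is 1 - block_upper; its
    floor (n^2 / 4) nonzero entries are distinct positive integers. *)
Definition block_upper n : 'M[C]_n :=
  \matrix_(i, j) (if (i < n./2 <= j)%N then (i * n + j).+1%:R else 0).

Lemma block_upper_sqr n : block_upper n *m block_upper n = 0.
Proof.
apply/matrixP => i j; rewrite !mxE big1 // => k _; rewrite !mxE.
have [h|h] := leqP n./2 k; last by rewrite andbF mul0r.
by rewrite mulr0.
Qed.

Lemma block_upper_inv n :
  1%:M + block_upper n \in unitmx /\ invmx (1%:M + block_upper n) = 1%:M - block_upper n.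
Proof.
have E : (1%:M + block_upper n) *m (1%:M - block_upper n) = 1%:M.
  rewrite mulmxBr mulmx1 mulmxDl mul1mx block_upper_sqr addr0.
  by rewrite addrK.
have [u _] := mulmx1_unit E; split=> //.
by apply: (can_inj (mulKmx u)); rewrite E mulmxV.
Qed.

(** Run the inversion on 1 + block_upper, without errors, at a precision for which
    the output is accurate to 1/2. The relevant entries of the inverse are
    distinct negative integers, whereas the inputs, 0 and u are nonnegative, so
    each of these outputs had to be computed by an operation of its own. *)
Lemma stable_inversion_ops_ge (INV : cmd) (mu : nat -> R) (c : R) (T : nat -> nat) n :
  stable_inversion INV mu c T -> (1 < n)%N -> (n ^ 2 <= 8 * T n)%N.
Proof.
move=> stab n1; have [uA VA] := block_upper_inv n.
set A := 1%:M + block_upper n in uA VA.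
set G := mu n * (cond A `^ (c * ln n%:R)) * opnorm (invmx A).
pose u : R := (2 * (`|G| + 1))^-1.
have G0 : 0 <= `|G| by exact: normr_ge0.
have u0 : 0 < u by rewrite /u invr_gt0; lra.
have u1 : u < 1 by rewrite /u invf_lt1; lra.
have uG : u * G < 1 / 2.
  apply: (@le_lt_trans _ _ (u * `|G|)); first by rewrite ler_pM2l // ler_norm.
  rewrite /u mulrC ltr_pdivrMr; lra.
have [] := stab n A A u (fun=> 0) n1 uA _ _ _.
- by rewrite u0 u1.
- by move=> i j; exists 0; rewrite ?normc0 ?ltW // addr0 mul1r.
- by move=> k; rewrite normc0 ltW.
move=> s [/exec_traced [L [sL tr]] opsT acc].
have err : opnorm (mx_of_arr n (fmem s 0%N) - invmx A) < 1 / 2.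
  apply: le_lt_trans acc _; have -> : mu n * u * cond A `^ (c * ln n%:R) * opnorm (invmx A) = u * G.
    by rewrite /G; ring.
  exact: uG.
have near (i j : nat) : [&& i < n./2, n./2 <= j & j < n]%N ->
    `|Re (fmem s 0%N i j) + (i * n + j).+1%:R| < 1 / 2.
  move=> /and3P[ih hj jn]; have hn : (n./2 <= n)%N by lia.
  have i_n : (i < n)%N := leq_trans ih hn.
  apply: le_lt_trans err; apply: le_trans (normc_entry _ (Ordinal i_n) (Ordinal jn)).
  rewrite VA !mxE /= ih hj /=.
  have -> : (Ordinal i_n == Ordinal jn) = false.
    by apply/eqP => -[E]; move: ih; rewrite E ltnNge hj.
  rewrite mulr0n sub0r opprK; apply: le_trans (ler_Re_normc _).
  have -> : ((i * n + j).+1%:R : C) = ((i * n + j).+1%:R : R)%:C by rewrite rmorph_nat.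
  by case: (fmem s 0%N i j).
have neg i j : [&& i < n./2, n./2 <= j & j < n]%N -> Re (fmem s 0%N i j) < 0.
  move=> /near; rewrite ltr_norml => /andP[_ h].
  have : 1 <= (i * n + j).+1%:R :> R by rewrite ler1n.
  by move: h; clear; lra.
have ReA a i j : 0 <= Re (fmem (init n [:: arr_of_mx A] 0) a i j).
  case: a => [|a] /=; last by rewrite nth_default.
  have [->//|[i' [j' ->]]] := arr_of_mxE A i j.
  rewrite !mxE raddfD /=.
  have Ren (m : nat) : 0 <= Re (m%:R : C).
    have -> : (m%:R : C) = (m%:R : R)%:C by rewrite rmorph_nat.
    by rewrite /= ler0n.
  by apply: addr_ge0 => //; case: ifP => _ //; apply: Ren.
have inL i j : [&& i < n./2, n./2 <= j & j < n]%N -> fmem s 0%N i j \in L.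
  move=> /neg; case: (tr 0%N i j) => // [->|->|[a [i' [j' ->]]]].
  - by rewrite ltxx.
  - by rewrite /= ltNge ltW.
  - by rewrite ltNge ReA.
pose f (p : 'I_(n./2) * 'I_(n - n./2)) := fmem s 0%N p.1 (n./2 + p.2).
have rng (p : 'I_(n./2) * 'I_(n - n./2)) : [&& p.1 < n./2, n./2 <= n./2 + p.2 & n./2 + p.2 < n]%N.
  by have := ltn_ord p.1; have := ltn_ord p.2; lia.
have injf : injective f.
  move=> p q pq; have := near _ _ (rng p); have := near _ _ (rng q).
  rewrite -/(f p) -/(f q) pq !ltr_norml => /andP[h1 h2] /andP[h3 h4].
  set a := (p.1 * n + _)%N in h3 h4; set b := (q.1 * n + _)%N in h1 h2.
  have close (k l : nat) (x : R) : x + k.+1%:R < 1 / 2 -> - (1 / 2) < x + l.+1%:R ->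
      (k < l.+1)%N.
    rewrite -(ltr_nat R) -[k.+1%:R]natr1 -[l.+1%:R]natr1.
    by move: (k%:R) (l%:R) => y z; clear; lra.
  have ab := close _ _ _ h4 h1; have ba := close _ _ _ h2 h3.
  have E : a = b by apply/eqP; rewrite eqn_leq -[(a <= b)%N]ltnS -[(b <= a)%N]ltnS ab ba.
  have := rng p; have := rng q; move: E; rewrite /a /b => E.
  have n0 : (0 < n)%N := ltnW n1.
  move=> /and3P[_ _ hq] /and3P[_ _ hp].
  have E1 : p.1 = q.1 :> nat.
    by have := congr1 (divn^~ n) E; rewrite !divnMDl // !divn_small // !addn0.
  have E2 : p.2 = q.2 :> nat by move: E; rewrite E1 => /addnI /addnI.
  by case: (p) (q) E1 E2 => p1 p2 [q1 q2] /= /val_inj -> /val_inj ->.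
have card : (n./2 * (n - n./2) <= T n)%N.
  have := @uniq_leq_size _ (map f (enum {: 'I_(n./2) * 'I_(n - n./2)})) L.
  rewrite map_inj_uniq // enum_uniq => /(_ isT).
  rewrite size_map -cardE card_prod !card_ord => h.
  apply: leq_trans (h _) _; first by move=> x /mapP [p _ ->]; apply: inL.
  by apply: leq_trans opsT; move: sL; rewrite /= addn0.
move: card n1 (odd_double_half n); clear; rewrite -mul2n.
by move: n./2 (T n) => h t; case: (odd n) => /= ht n1 En; subst n; nia.
Qed.

End OperationLowerBound.

(** * Total correctness of programs *)

Section ProgramLogic.
Variable R : realType.
Local Notation C := R[i].
Variables (u : R) (d : nat -> C).
Implicit Types (s : state R) (c : cmd) (Q : state R -> Prop).

Definition run c s Q := exists2 s', exec u d c s s' & Q s'.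

Lemma run_weaken c s Q Q' : run c s Q -> (forall s', Q s' -> Q' s') -> run c s Q'.
Proof. by case=> s' e q h; exists s' => //; apply: h. Qed.

Lemma run_seq c1 c2 s Q : run c1 s (fun s1 => run c2 s1 Q) -> run (Seq c1 c2) s Q.
Proof. by case=> s1 e1 [s2 e2 q]; exists s2 => //; apply: exec_seq e1 e2. Qed.

Lemma run_nset x e s Q :
  Q (State (upd (nvar s) x (neval s e)) (fmem s) (ops s)) -> run (NSet x e) s Q.
Proof. by move=> q; eexists; [exact: exec_nset|]. Qed.

Lemma run_fset l f s x Q : feval s f = Some x ->
  Q (State (nvar s) (put s l (x * (1 + d (ops s)))) (ops s).+1) -> run (FSet l f) s Q.
Proof. by move=> fx q; eexists; [exact: exec_fset fx|]. Qed.

(** The invariant I counts the iterations, and N bounds their number. *)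
Lemma run_while t c (I : nat -> state R -> Prop) N k s Q :
  (forall k s, I k s -> teval s t -> (k < N)%N /\ run c (tick s t) (I k.+1)) ->
  (forall k s, I k s -> ~~ teval s t -> Q (tick s t)) ->
  I k s -> run (While t c) s Q.
Proof.
move=> step stop; move: {2}(N - k)%N (leqnn (N - k)) => m.
elim: m k s => [|m IH] k s hm Is.
  have [tT|tF] := boolP (teval s t).
    by have [kN _] := step _ _ Is tT; lia.
  by exists (tick s t); [exact: exec_while_false|exact: stop Is tF].
have [tT|tF] := boolP (teval s t); last first.
  by exists (tick s t); [exact: exec_while_false|exact: stop Is tF].
have [kN [s1 e1 I1]] := step _ _ Is tT.
have [|s2 e2 q] := IH k.+1 s1 _ I1; first by lia.
by exists s2 => //; apply: exec_while_true e1 e2.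
Qed.

End ProgramLogic.

(** * The program and its building blocks *)

Section Rounding.
Variable R : realType.
Local Notation C := R[i].

Lemma rounding_error (u : R) (a b e : C) : u <= 1 / 10 ->
  normc a <= u -> normc b <= u -> normc e <= u ->
  1 + e != 0 /\ normc ((1 + a) * (1 + b) / (1 + e) - 1) <= 4 * u.
Proof.
move=> u10 ha hb he.
have u0 : 0 <= u := le_trans (normc_ge0 a) ha.
have e9 : 9 / 10 <= normc (1 + e).
  have := le_normcD (1 + e) (- e); rewrite addrK normc1 normcN; lra.
have ne : 1 + e != 0 by apply/eqP => h; move: e9; rewrite h normc0; lra.
split=> //.
have -> : (1 + a) * (1 + b) / (1 + e) - 1 = (a + b + a * b - e) / (1 + e) by field.
rewrite normcM normcV ler_pdivrMr; last by lra.
have h : normc (a + b + a * b - e) <= 3 * u + u * u.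
  apply: le_trans (le_normcD _ _) _; rewrite normcN.
  have := le_normcD (a + b) (a * b); have := le_normcD a b; rewrite normcM.
  have : normc a * normc b <= u * u by apply: ler_pM => //; exact: normc_ge0.
  lra.
apply: le_trans h _; nra.
Qed.
End Rounding.

(** Number variables: 0 the dimension, 1 the number of Newton steps, 2 the steps
    done, 3 and 4 row and column, 5 a candidate power of 2. Arrays: 0 the
    iterate, 1 the input K, 2 the input beta, then 1 / beta, 3 the computed
    inverse, 4 the constant 2, 5 the candidate, 6 the constant 1, 7 the next
    iterate. *)
Definition cell a := Loc a (NCst 0) (NCst 0).
Definition entry a := Loc a (NVar 3) (NVar 4).
Definition incr x := NSet x (NAdd (NVar x) (NCst 1)).

Definition average : cmd :=
  Seq (NSet 3 (NCst 0))
  (While (NLt (NVar 3) (NVar 0))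
    (Seq (NSet 4 (NCst 0))
    (Seq
      (While (NLt (NVar 4) (NVar 0))
        (Seq (FSet (entry 7) (FBin FAdd (entry 0) (entry 3)))
        (Seq (FSet (entry 7) (FBin FDiv (entry 7) (cell 4)))
             (incr 4))))
      (incr 3)))).

(** Calling the empty program copies array 7 into array 0. *)
Definition newton_step (INV : cmd) : cmd :=
  Seq (Call INV (NVar 0) 0 3) (Seq average (Call Skip (NVar 0) 7 0)).

Definition load_candidate := FSet (cell 5) (FCst (NVar 5) (NCst 0)).

(** Candidates are computed exactly as natural numbers and reloaded before each
    comparison, so that their rounding errors do not accumulate. *)
Definition search (a p0 : nat) (next : nexp) (inc : nat) : cmd :=
  Seq (NSet 5 (NCst p0))
  (Seq load_candidate
  (While (FLt (cell 5) (cell a))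
    (Seq (NSet 5 next)
    (Seq (NSet 1 (NAdd (NVar 1) (NCst inc)))
         load_candidate)))).

Definition sgn_program (INV : cmd) : cmd :=
  Seq (NSet 1 (NCst 21))
  (Seq (search 1 1 (NAdd (NVar 5) (NVar 5)) 5)
  (Seq (FSet (cell 6) (FCst (NCst 1) (NCst 0)))
  (Seq (FSet (cell 2) (FBin FDiv (cell 6) (cell 2)))
  (Seq (search 2 2 (NMul (NVar 5) (NVar 5)) 1)
  (Seq (FSet (cell 4) (FCst (NCst 2) (NCst 0)))
  (Seq (NSet 2 (NCst 0))
  (While (NLt (NVar 2) (NVar 1)) (Seq (newton_step INV) (incr 2))))))))).

Section ProgramSpecs.
Variable R : realType.
Local Notation C := R[i].
Variables (u : R) (d : nat -> C).
Hypotheses (u0 : 0 < u) (u10 : u <= 1 / 10) (adv : adversary u d).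
Implicit Types (s : state R).

Definition same_counters s s' :=
  [/\ nvar s' 0%N = nvar s 0%N, nvar s' 1%N = nvar s 1%N & nvar s' 2%N = nvar s 2%N].

Definition averaged s (x : C) i j :=
  normc (x - 2^-1 * (fmem s 0%N i j + fmem s 3%N i j))
  <= 2 * u * normc (fmem s 0%N i j + fmem s 3%N i j).

Lemma averaged_rounding s i j (d0 d1 d2 : C) :
  normc d0 <= u -> normc d1 <= u -> normc d2 <= u ->
  averaged s ((fmem s 0%N i j + fmem s 3%N i j) * (1 + d1) / (2 * (1 + d0)) * (1 + d2)) i j.
Proof.
move=> h0 h1 h2; rewrite /averaged; set x := fmem s 0%N i j + fmem s 3%N i j.
have [ne h] := rounding_error u10 h1 h2 h0.
have -> : x * (1 + d1) / (2 * (1 + d0)) * (1 + d2) - 2^-1 * x =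
   (2^-1 * x) * ((1 + d1) * (1 + d2) / (1 + d0) - 1).
  by field.
rewrite normcM normcM normc_half.
have x0 := normc_ge0 x.
have : normc x * normc ((1 + d1) * (1 + d2) / (1 + d0) - 1) <= normc x * (4 * u).
  by rewrite ler_wpM2l.
lra.
Qed.

(** The loop invariant when the rows before i are done, and row i is done up to
    column k. *)
Definition averaging s i k s' :=
  [/\ same_counters s s', nvar s' 3%N = i,
      forall a, a != 7%N -> fmem s' a = fmem s a,
      ops s' = (ops s + 2 * (i * nvar s 0%N + k))%N &
      forall i' j', (j' < nvar s 0)%N -> (i' < i)%N || (i' == i) && (j' < k)%N ->
        averaged s (fmem s' 7%N i' j') i' j'].

Lemma run_average s (d0 : C) :
  fmem s 4%N 0%N 0%N = 2 * (1 + d0) -> normc d0 <= u ->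
  run u d average s (fun s' =>
    [/\ same_counters s s', forall a, a != 7%N -> fmem s' a = fmem s a,
        ops s' = (ops s + 2 * (nvar s 0 * nvar s 0))%N &
        forall i j, (i < nvar s 0)%N -> (j < nvar s 0)%N -> averaged s (fmem s' 7%N i j) i j]).
Proof.
move=> two hd0; apply: run_seq; apply: run_nset.
set n := nvar s 0%N.
have ne0 : fmem s 4%N 0%N 0%N != 0.
  have [ne _] := rounding_error u10 hd0 hd0 hd0.
  by rewrite two mulf_neq0 // pnatr_eq0.
apply: (@run_while _ _ _ _ _ (fun i s' => averaging s i 0 s' /\ (i <= n)%N) n 0).
- move=> i s1 [[cs e3 fr op av] i_n] /=; rewrite e3 => lt.
  have [c0 c1 c2] := cs.
  rewrite c0 -/n in lt; split=> //.
  apply: run_seq; apply: run_nset; apply: run_seq.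
  apply: (@run_while _ _ _ _ _ (fun k s' => [/\ averaging s i k s', nvar s' 4%N = k & (k <= n)%N]) n 0).
  + move=> k s2 [[cs' e3' fr' op' av'] e4 k_n] /=; rewrite e4.
    have [c0' c1' c2'] := cs'.
    rewrite c0' -/n => kn; split=> //.
    apply: run_seq; apply: run_fset; first by [].
    apply: run_seq; apply: run_fset.
      rewrite /= /upd /= fr' // (negbTE ne0) !eqxx; reflexivity.
    apply: run_nset; split; last by [].
      split=> //.
      * by move=> a a7; rewrite /= /upd (negbTE a7) fr'.
      * by rewrite /= op'; lia.
      * move=> i' j' j'n; rewrite /= /upd /= e3' e4 !eqxx ltnS => h.
        have [ei|ni] := eqVneq i' i; last first.
          by apply: av' => //; move: h; rewrite (negbTE ni) !orbF.
        have [ej|nj] := eqVneq j' k; last first.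
          rewrite ei; apply: av' => //; move: h; rewrite ei ltnn eqxx /=; lia.
        by rewrite ei ej !fr' // two; apply: averaged_rounding.
    by rewrite /= /upd /= e4 addn1.
  + move=> k s2 [[cs' e3' fr' op' av'] e4 k_n] /=; rewrite e4.
    have [c0' c1' c2'] := cs'; rewrite c0' -/n -leqNgt => nk.
    have Ek : k = n by apply/eqP; rewrite eqn_leq k_n.
    apply: run_nset; rewrite /= e3'; split; last by lia.
    split=> //.
    * by rewrite /upd /= addn1.
    * by rewrite /= op' Ek /n; lia.
    * move=> i' j' j'n; move/orP; case; last by case/andP.
      rewrite ltnS leq_eqVlt => h.
      by apply: av' => //; rewrite Ek j'n andbT orbC.
  + split=> //; split=> //.
- move=> i s1 [[cs e3 fr op av] i_n] /=; have [c0 c1 c2] := cs.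
  rewrite e3 c0 -/n -leqNgt => ni.
  have Ei : i = n by apply/eqP; rewrite eqn_leq i_n.
  split=> //; first by rewrite op Ei; lia.
  by move=> i' j' hi hj; apply: av => //; rewrite Ei hi.
- split=> //; split=> //; first by rewrite /= mul0n addn0 muln0 addn0.
  by move=> i' j' _; rewrite /= andbF.
Qed.

End ProgramSpecs.

Section NewtonStepSpec.
Variable R : realType.
Local Notation C := R[i].
Variables (u : R) (d : nat -> C).
Hypotheses (u0 : 0 < u) (u10 : u <= 1 / 10) (adv : adversary u d).
Implicit Types (s : state R).

Definition inversion_error (mu : nat -> R) (c : R) n (X : 'M[C]_n) : R :=
  mu n * u * (cond X `^ (c * ln n%:R)) * opnorm (invmx X).

(** The first term accounts for the rounding errors of the averages, entry by
    entry, the second one for half the error of the computed inverse. *)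
Lemma run_newton_step (INV : cmd) (mu : nat -> R) (c : R) (T : nat -> nat)
    (s : state R) (n : nat) (X : 'M[C]_n) (d0 : C) :
  stable_inversion INV mu c T -> (1 < n)%N -> nvar s 0%N = n ->
  mx_of_arr n (fmem s 0%N) = X -> X \in unitmx ->
  fmem s 4%N 0%N 0%N = 2 * (1 + d0) -> normc d0 <= u ->
  run u d (newton_step INV) s (fun s' =>
    [/\ same_counters s s', fmem s' 4%N = fmem s 4%N,
        (ops s' <= ops s + (T n + 2 * (n * n)))%N &
        opnorm (mx_of_arr n (fmem s' 0%N) - newton X) <=
          n%:R * (2 * u * (opnorm X + (opnorm (invmx X) + inversion_error mu c X)))
          + 2^-1 * inversion_error mu c X]).
Proof.
move=> stab n1 s0n sX uX two hd0.
have [] := stab n X X u (fun i => d (i + ops s)%N) n1 uX _ _ _.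
- by rewrite u0 (le_lt_trans u10) // ltr_pdivrMr // mul1r ltr1n.
- by move=> i j; exists 0; rewrite ?normc0 ?(ltW u0) // addr0 mul1r.
- by move=> k; apply: adv.
move=> s1 [e1 o1 acc]; apply: run_seq.
have := exec_call 3 (a := 0) (e := NVar 0) (s := s) (s' := delay (ops s) s1).
rewrite /= s0n sX => /(_ _ _ _ (exec_delay e1)) ex0.
pose Z : 'M[C]_n := mx_of_arr n (fmem s1 0%N).
pose s2 := State (nvar s) (upd (fmem s) 3 (arr_of_mx Z)) (ops s1 + ops s)%N.
have ex : exec u d (Call INV (NVar 0) 0 3) s s2 := ex0.
exists s2 => //; clear ex0 ex.
apply: run_seq; apply: run_weaken.
  by apply: (@run_average R u d u0 u10 adv s2 d0); rewrite /s2 /= /upd /=.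
move=> s3 [[c0 c1 c2] fr op av].
eexists; first by apply: exec_call; apply: exec_skip.
have c0n : nvar s3 0%N = n by rewrite c0.
rewrite /= c0n /upd /= !arr_of_mxK; split.
- by split.
- by rewrite fr.
- by rewrite op /s2 /= s0n; lia.
set M := mx_of_arr n _.
have Zacc : opnorm (Z - invmx X) <= inversion_error mu c X by exact: acc.
have -> : M - newton X = (M - 2^-1 *: (X + Z)) + 2^-1 *: (Z - invmx X).
  rewrite /newton; apply/matrixP => i j; rewrite !mxE.
  by move: (invmx X i j) => y; field.
apply: opnormD_le; last by apply: opnormZ_le; rewrite ?normc_half.
have Znorm : opnorm Z <= opnorm (invmx X) + inversion_error mu c X.
  by rewrite -[Z](subrK (invmx X)) addrC; apply: opnormD_le.
apply: opnorm_entries.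
  apply: mulr_ge0; first by rewrite mulr_ge0 // ltW.
  by apply: addr_ge0; [apply: opnorm_ge0|apply: le_trans Znorm; apply: opnorm_ge0].
move=> i j.
have := av i j; rewrite /s2 /= s0n => /(_ (ltn_ord i) (ltn_ord j)).
have Xij : fmem s 0%N i j = X i j by rewrite -sX mxE.
have Zij : arr_of_mx Z i j = Z i j by rewrite /arr_of_mx !valK.
rewrite /averaged /upd /= Xij Zij => h.
have -> : (M - 2^-1 *: (X + Z)) i j = fmem s3 7%N i j - 2^-1 * (X i j + Z i j).
  by rewrite !mxE.
apply: le_trans h _; rewrite ler_wpM2l //; first by rewrite mulr_ge0 // ltW.
apply: le_trans (le_normcD _ _) _; apply: lerD; first exact: normc_entry.
exact: le_trans (normc_entry _ _ _) Znorm.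
Qed.

(** The search stops at the first candidate which, as loaded, reaches the
    threshold; candidate m0 does so whatever its rounding error. *)
Lemma run_search a p0 next inc op s m0 :
  (forall s, neval s next = op (nvar s 5%N)) -> a != 5%N ->
  Re (fmem s a 0%N 0%N) <= (iter m0 op p0)%:R * (1 - u) ->
  run u d (search a p0 next inc) s (fun s' => exists m,
    [/\ (m <= m0)%N, Re (fmem s a 0%N 0%N) <= (iter m op p0)%:R * (1 + u),
        [/\ nvar s' 0%N = nvar s 0%N & nvar s' 1%N = (nvar s 1 + inc * m)%N],
        forall b, b != 5%N -> fmem s' b = fmem s b &
        ops s' = (ops s + 2 * m + 2)%N]).
Proof.
move=> opE a5 hm0; set x := fmem s a 0%N 0%N.
pose I k s' := [/\ nvar s' 5%N = iter k op p0,
  [/\ nvar s' 0%N = nvar s 0%N & nvar s' 1%N = (nvar s 1 + inc * k)%N],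
  forall b, b != 5%N -> fmem s' b = fmem s b,
  ops s' = (ops s + 2 * k + 1)%N & (k <= m0)%N /\
  exists2 e, normc e <= u & fmem s' 5%N 0%N 0%N = ((iter k op p0)%:R : R)%:C * (1 + e)].
have ReE (p : nat) (e : C) : normc e <= u ->
    p%:R * (1 - u) <= Re ((p%:R : R)%:C * (1 + e)) <= p%:R * (1 + u).
  move=> he; have := le_trans (ler_Re_normc e) he; rewrite ler_norml.
  have -> : Re ((p%:R : R)%:C * (1 + e)) = p%:R * (1 + Re e).
    by case: e {he} => y z /=; rewrite mul0r subr0.
  by move=> /andP[h1 h2]; apply/andP; split; rewrite ler_wpM2l //; lra.
apply: run_seq; apply: run_nset; apply: run_seq; apply: run_fset; first by [].
apply: (@run_while _ _ _ _ _ I m0 0).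
- move=> k s' [e5 [e0 e1] fr op' [k_m0 [e he ve]]] /= lt.
  have k1 : (k < m0)%N.
    rewrite ltn_neqAle k_m0 andbT; apply/eqP => km.
    move: lt; rewrite ve (fr a a5) -/x km => lt.
    have /andP[h _] := ReE (iter m0 op p0) e he.
    by have := le_lt_trans h lt; rewrite ltNge hm0.
  split=> //; apply: run_seq; apply: run_nset; apply: run_seq; apply: run_nset.
  apply: run_fset; first by [].
  split.
  + by rewrite /= /upd /= opE /= e5.
  + by split; rewrite /= /upd /= ?e0 // e1 mulnS addnA addnAC.
  + by move=> b b5; rewrite /= /upd (negbTE b5) fr.
  + by rewrite /= op'; lia.
  + split=> //; exists (d (ops s').+1); first exact: adv.
    by rewrite /= /upd /= opE /= e5.
- move=> k s' [e5 [e0 e1] fr op' [k_m0 [e he ve]]] /=.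
  rewrite -leNgt ve (fr a a5) -/x => le.
  exists k; split=> //; last by rewrite op'; lia.
  have /andP[_ h] := ReE (iter k op p0) e he; exact: le_trans le h.
- split=> //=.
  + by split=> //; rewrite muln0 addn0.
  + by move=> b b5; rewrite /upd (negbTE b5).
  + by rewrite muln0 addn0 addn1.
  + by split=> //; exists (d (ops s)); first exact: adv.
Qed.

End NewtonStepSpec.

(** * The precision dominates all losses *)

Section Numerics.
Variable R : realType.

Lemma expR_half_le2 : expR (1 / 2) <= 2 :> R.
Proof.
have := expR_ge1Dx (- (1 / 2) : R); rewrite expRN => h.
have e0 : 0 < expR (1 / 2) :> R by exact: expR_gt0.
have : expR (1 / 2) * (1 + - (1 / 2)) <= expR (1 / 2) * (expR (1 / 2))^-1 :> R.
  by rewrite ler_pM2l.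
rewrite mulfV; last by rewrite lt0r_neq0.
by move: (expR _) => x; lra.
Qed.

Lemma ln2_ge_half : 1 / 2 <= ln 2 :> R.
Proof.
rewrite -[X in X <= _]expRK ler_ln ?posrE ?expR_gt0 //; exact: expR_half_le2.
Qed.

Lemma ln_ge_half (x : R) : 2 <= x -> 1 / 2 <= ln x.
Proof.
move=> x2; apply: le_trans ln2_ge_half _; rewrite ler_ln ?posrE //.
exact: lt_le_trans x2.
Qed.

Lemma ln_inv_ge1 (b : R) : 0 < b < 1 / 12 -> 1 <= ln (1 / b).
Proof.
move=> /andP[b0 b12].
rewrite -[X in X <= _]expRK ler_ln ?posrE ?expR_gt0 ?divr_gt0 //.
have -> : (1 : R) = 1 / 2 + 1 / 2 by lra.
rewrite expRD; have e := expR_half_le2; have e0 := expR_ge0 (1 / 2 : R).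
have : 12 <= (1 / 2 + 1 / 2) / b :> R by rewrite ler_pdivlMr //; lra.
move: (expR _) e e0 => x; nra.
Qed.

(** The square root of e is at most 2, so 2 ^ m is at least exp (m / 2). *)
Lemma pow2_reaches (y : R) : 0 <= y ->
  exists2 m : nat, m%:R <= 2 * y + 3 & 2 * expR y <= 2 ^+ m.
Proof.
move=> y0; have y20 : 0 <= 2 * y by lra.
have := truncn_itv y20; set t := Num.truncn _; move: t => t /andP[h1 h2].
have t3 : t.+3%:R = t%:R + 3 :> R by rewrite -addn3 natrD.
have t1 : t.+1%:R = t%:R + 1 :> R by rewrite -natr1.
exists t.+3; first by rewrite t3; lra.
apply: (@le_trans _ _ (expR (1 / 2) ^+ t.+3)); last first.
  by apply: lerXn2r expR_half_le2; rewrite nnegrE ?expR_ge0.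
rewrite -expRM_natr; apply: (@le_trans _ _ (expR (1 + y))).
  rewrite expRD ler_pM2r ?expR_gt0 //; apply: le_trans (expR_ge1Dx _).
  by lra.
by rewrite ler_expR t3; lra.
Qed.

Lemma leD_expR (x y : R) : 0 <= x -> 0 < y -> x + ln y <= expR (x + y).
Proof.
move=> x0 y0; have := ln_sublinear y0; have := expR_ge1Dx (x + y); lra.
Qed.

(** All logarithms are at least 1/2, so that x y^3 (y + z) dominates each monomial
    of the exponent up to a factor 16. *)
Lemma precision_dominates (x y z D k c : R) :
  1 / 2 <= x -> 1 / 2 <= y -> 1 <= z -> 0 <= D -> 0 <= k -> 0 <= c ->
  D + (4 * y + 2 * z + (1 + k) * x + 9 * (c * (y * x)))
    <= 16 * (D + 7 + k + 9 * c) * (x * y ^+ 3 * (y + z)).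
Proof.
move=> xh yh zh D0 k0 c0; set P := x * y ^+ 3 * (y + z).
have y2 : 1 / 4 <= y ^+ 2 by nra.
have y3 : 1 / 8 <= y ^+ 3 by rewrite exprS; nra.
have x0 : 0 < x by lra.
have y0 : 0 < y by lra.
have xy3 : x * y ^+ 3 <= P.
  by rewrite -[leLHS]mulr1 ler_wpM2l ?mulr_ge0 ?exprn_ge0 ?(ltW x0) ?(ltW y0) //; lra.
have nK : 1 / 16 <= x * y ^+ 3 by nra.
have Pz : 1 / 16 * (y + z) <= P by rewrite /P ler_wpM2r //; lra.
have Px : x * (1 / 8) <= x * y ^+ 3 by rewrite ler_pM2l.
have Pxy : y * x * (1 / 4) <= x * y ^+ 3.
  have -> : x * y ^+ 3 = y * x * y ^+ 2 by ring.
  by rewrite ler_pM2l // mulr_gt0.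
have h1 : D * 1 <= D * (16 * P) by rewrite ler_wpM2l //; lra.
have h2 : (1 + k) * x <= (1 + k) * (16 * P) by rewrite ler_wpM2l //; lra.
have h3 : c * (y * x) <= c * (16 * P) by rewrite ler_wpM2l //; lra.
have -> : 16 * (D + 7 + k + 9 * c) * P = D * (16 * P) + 6 * (16 * P) +
   (1 + k) * (16 * P) + 9 * (c * (16 * P)) by ring.
move: h1 h2 h3 Pz nK xy3; clearbody P; clear -yh zh; lra.
Qed.

(** Here Q stands for the number of steps, and 180 u n (5 K)^3 mu (100 K^2)^(c ln n)
    for the drift caused by one of them. In logarithmic form the left hand side
    is ln u plus a combination of ln K, ln (1 / beta), ln n and ln n ln K, and
    each of these is dominated by the product P which measures the precision. *)
Lemma small_precision (mu : nat -> R) (c a : R) (k : nat) :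
  (forall n, (1 < n)%N -> mu n <= a * n%:R ^+ k) ->
  (forall n, (1 < n)%N -> 1 <= mu n) ->
  (forall n, (1 < n)%N -> 1 <= c * ln n%:R) ->
  exists Cbits : R, forall (n : nat) (K beta u Q : R),
    (1 < n)%N -> 1 <= K -> 0 < beta < 1 / 12 -> 0 < u ->
    Cbits * (ln n%:R * ln (Num.max K 2) ^+ 3
           * (ln (Num.max K 2) + ln (1 / beta))) <= lg (1 / u) ->
    0 <= Q <= 100 * (ln (Num.max K 2) + ln (ln (1 / beta))) ->
    Q * (180 * u * n%:R * (5 * K) ^+ 3 *
      (mu n * (4 * (5 * K) ^+ 2) `^ (c * ln n%:R))) <= beta / 2.
Proof.
move=> mu_le mu_ge c_ge.
have a0 : 0 <= a.
  have := le_trans (mu_ge 2%N isT) (mu_le 2%N isT).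
  by move=> h; rewrite leNgt; apply/negP => an; move: h; rewrite leNgt (lt_trans _ ltr01) // nmulr_rlt0 // exprn_gt0.
have [N N1 eN] : exists2 N : R, 1 <= N & N = 100 * (125 * 180).
  exists (100 * (125 * 180)) => //.
  by do 2 (apply: mulr_ege1; first by rewrite ler1n); rewrite ler1n.
pose D := ln (2 * (N * (a + 1))).
have D0 : 0 <= D.
  apply: ln_ge0; have : 1 * 1 <= N * (a + 1) by apply: ler_pM => //; lra.
  by lra.
have c0 : 0 <= c.
  have ln20 : 0 < ln 2%:R :> R by apply: lt_le_trans ln2_ge_half; lra.
  by have := c_ge 2%N isT; rewrite -ler_pdivrMr //; apply: le_trans; rewrite divr_ge0 // ltW.
exists (32 * (D + 7 + k%:R + 9 * c)) => n K beta u Q n1 K1 hb u0 bits /andP[Q0 hQ].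
have /andP[b0 b12] := hb.
set K2 := Num.max K 2 in bits hQ.
have K22 : 2 <= K2 by rewrite /K2 le_max lexx orbT.
have KK2 : K <= K2 by rewrite /K2 le_max lexx.
have K20 : 0 < K2 by lra.
set lK := ln K2 in bits hQ; set lb := ln (1 / beta) in bits hQ; set ln_n := ln n%:R in bits *.
have lKh : 1 / 2 <= lK by exact: ln_ge_half.
have lnh : 1 / 2 <= ln_n by apply: ln_ge_half; rewrite (ler_nat R 2).
have lbh : 1 <= lb by exact: ln_inv_ge1.
have eK : expR lK = K2 by rewrite lnK ?posrE.
have n0 : 0 < n%:R :> R by rewrite ltr0n; apply: ltnW.
have en : expR ln_n = n%:R by rewrite lnK ?posrE.
have eb : expR lb = 1 / beta by rewrite lnK ?posrE // divr_gt0.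
set P := ln_n * lK ^+ 3 * (lK + lb) in bits.
set E := 4 * lK + 2 * lb + (1 + k%:R) * ln_n + 9 * (c * (lK * ln_n)).
have DE : D + E <= ln (1 / u).
  have l2 := ln2_ge_half.
  have hx : 16 * (D + 7 + k%:R + 9 * c) * P <= ln (1 / u).
    move: bits; rewrite /lg ler_pdivlMr; last by lra.
    apply: le_trans.
    have lK0 : 0 <= lK by apply: le_trans lKh; rewrite divr_ge0.
    have P0 : 0 <= P.
      apply: mulr_ge0; last exact: addr_ge0 lK0 (le_trans ler01 lbh).
      by apply: mulr_ge0; [apply: le_trans lnh; rewrite divr_ge0|apply: exprn_ge0].
    have cP : 0 <= (D + 7 + k%:R + 9 * c) * P.
      by apply: mulr_ge0 => //; rewrite !addr_ge0 ?mulr_ge0.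
    move: cP l2; clear; set y := _ * P => y0.
    have -> : 32 * (D + 7 + k%:R + 9 * c) * P = 32 * y by rewrite /y; ring.
    have -> : 16 * (D + 7 + k%:R + 9 * c) * P = 16 * y by rewrite /y; ring.
    by move=> *; nra.
  apply: le_trans hx; apply: precision_dominates => //; exact: ler0n.
have aexp : 2 * (N * a) <= expR D.
  have N0 : 0 < N by lra.
  rewrite lnK ?posrE; first by rewrite ler_pM2l // ler_pM2l //; lra.
  by do 2 (apply: mulr_gt0 => //); lra.
have ue : u * expR (D + E) <= 1.
  have -> : (1 : R) = u * (1 / u) by field; rewrite lt0r_neq0.
  rewrite ler_pM2l //.
  have -> : 1 / u = expR (ln (1 / u)) by rewrite lnK // posrE divr_gt0.
  by rewrite ler_expR.
have Qe : Q <= 100 * expR (lK + lb).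
  apply: le_trans hQ _; rewrite ler_pM2l //; apply: leD_expR.
    by apply: le_trans lKh; rewrite divr_ge0.
  exact: lt_le_trans ltr01 lbh.
have K0 : 0 <= K := le_trans ler01 K1.
have B0 : 0 <= 5 * K := mulr_ge0 (ler0n _ 5) K0.
have B20 : 0 <= 5 * K2 := mulr_ge0 (ler0n _ 5) (ltW K20).
have BB : 5 * K <= 5 * K2 by rewrite ler_pM2l.
have K3 : (5 * K) ^+ 3 <= 125 * expR (3 * lK).
  have -> : expR (3 * lK) = K2 ^+ 3 by rewrite expRM_natl eK.
  have -> : 125 * K2 ^+ 3 = (5 * K2) ^+ 3 by ring.
  by apply: lerXn2r.
have muW : mu n <= a * expR (k%:R * ln_n) by rewrite expRM_natl en; exact: mu_le.
have hW : (4 * (5 * K) ^+ 2) `^ (c * ln_n) <= expR (9 * (c * (lK * ln_n))).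
  have -> : 9 * (c * (lK * ln_n)) = (9 * lK) * (c * ln_n) by ring.
  have -> : expR (9 * lK * (c * ln_n)) = (expR (9 * lK)) `^ (c * ln_n) by rewrite expRM.
  (* 4 (5 K)^2 <= K2 ^ 9, because 100 <= 2 ^ 7 <= K2 ^ 7 *)
  apply: ge0_ler_powR; rewrite ?nnegrE ?expR_ge0 //.
  - by apply: le_trans (c_ge n n1).
  - by rewrite mulr_ge0 // sqr_ge0.
  have -> : expR (9 * lK) = K2 ^+ 9 by rewrite expRM_natl eK.
  have h1 : (5 * K) ^+ 2 <= (5 * K2) ^+ 2 by apply: lerXn2r.
  have h2 : 2 ^+ 7 <= K2 ^+ 7 by apply: lerXn2r => //; rewrite nnegrE // ltW.
  have h3 : 0 <= K2 ^+ 2 by exact: sqr_ge0.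
  have h4 : 2 ^+ 7 * K2 ^+ 2 <= K2 ^+ 7 * K2 ^+ 2 by rewrite ler_wpM2r.
  have e7 : 2 ^+ 7 = 128 :> R by ring.
  rewrite e7 in h4; have -> : K2 ^+ 9 = K2 ^+ 7 * K2 ^+ 2 by rewrite -exprD.
  apply: le_trans h4; move: h1 h3; have -> : (5 * K2) ^+ 2 = 25 * K2 ^+ 2 by ring.
  by clear; move: (_ ^+ 2) (_ ^+ 2) => x y; lra.
have mu0 : 0 <= mu n := le_trans ler01 (mu_ge n n1).
have -> : Q * (180 * u * n%:R * (5 * K) ^+ 3 * (mu n * (4 * (5 * K) ^+ 2) `^ (c * ln_n)))
  = u * (Q * (5 * K) ^+ 3 * (180 * n%:R) * (mu n * (4 * (5 * K) ^+ 2) `^ (c * ln_n))) by ring.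
apply: (@le_trans _ _ (u * ((100 * expR (lK + lb)) * (125 * expR (3 * lK)) * (180 * expR ln_n) *
   ((a * expR (k%:R * ln_n)) * expR (9 * (c * (lK * ln_n))))))).
  have p0 : 0 <= (5 * K) ^+ 3 := exprn_ge0 3 B0.
  have w0 : 0 <= (4 * (5 * K) ^+ 2) `^ (c * ln_n) by exact: powR_ge0.
  rewrite ler_pM2l //; apply: ler_pM.
  - by apply: mulr_ge0; [exact: mulr_ge0|rewrite mulr_ge0 // ltW].
  - exact: mulr_ge0.
  - apply: ler_pM; [exact: mulr_ge0|by rewrite mulr_ge0 // ltW|exact: ler_pM|].
    by rewrite en.
  - exact: ler_pM.
have -> : u * (100 * expR (lK + lb) * (125 * expR (3 * lK)) * (180 * expR ln_n) *
   (a * expR (k%:R * ln_n) * expR (9 * (c * (lK * ln_n))))) =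
   u * (N * a) * expR (E - lb).
  have -> : E - lb = (lK + lb) + 3 * lK + ln_n + k%:R * ln_n + 9 * (c * (lK * ln_n)) by rewrite /E; ring.
  by rewrite ![expR (_ + _)]expRD eN; ring.
have -> : expR (E - lb) = expR E * beta by rewrite expRB eb div1r invrK.
rewrite [beta / 2]mulrC mulrA ler_pM2r //.
have h : u * (2 * (N * a)) * expR E <= 1.
  apply: le_trans ue; rewrite (expRD D E) [u * (expR D * _)]mulrA ler_pM2r ?expR_gt0 // ler_pM2l //.
have -> : u * (N * a) * expR E = 1 / 2 * (u * (2 * (N * a)) * expR E) by field.
by move: h; set y := _ * expR E; lra.
Qed.

End Numerics.

(** * Assembling the algorithm *)

Section Assembly.
Variable R : realType.
Local Notation C := R[i].

Lemma Re_scaled (r e : R) (z : C) : 0 <= r -> normc (z - 1) <= e ->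
  r * (1 - e) <= Re (r%:C * z) <= r * (1 + e).
Proof.
move=> r0 hz; have := le_trans (ler_Re_normc (z - 1)) hz.
case: z {hz} => x y /=; rewrite ler_norml mul0r subr0 => /andP[h1 h2].
by apply/andP; split; rewrite ler_wpM2l //; lra.
Qed.

(** Both ||X|| and ||X^-1|| are at most 2 B, so the condition number is at most
    4 B^2. *)
Lemma step_error_le (u B : R) (mu : nat -> R) (c : R) n (X : 'M[C]_n) :
  0 < u -> u <= 1 / 10 -> 1 <= B -> (1 < n)%N -> 1 <= mu n -> 0 <= c * ln n%:R ->
  opnorm X <= 2 * B -> opnorm (invmx X) <= 2 * B ->
  n%:R * (2 * u * (opnorm X + (opnorm (invmx X) + inversion_error u mu c X)))
    + 2^-1 * inversion_error u mu c X
  <= 10 * u * n%:R * B * (mu n * (4 * B ^+ 2) `^ (c * ln n%:R)).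
Proof.
move=> u0 u10 B1 n1 mu1 c0 hX hV.
have B0 : 0 <= B := le_trans ler01 B1.
have nn : 1 <= n%:R :> R by rewrite ler1n ltnW.
set W := mu n * _.
have cond_le : cond X <= 4 * B ^+ 2.
  have -> : 4 * B ^+ 2 = (2 * B) * (2 * B) by ring.
  by rewrite /cond; apply: ler_pM; [exact: opnorm_ge0|exact: opnorm_ge0|exact: hX|exact: hV].
have cond0 : 0 <= cond X by apply: mulr_ge0; apply: opnorm_ge0.
have W1 : 1 <= W.
  rewrite /W; apply: mulr_ege1 => //.
  have h : (4 * B ^+ 2) `^ 0 <= (4 * B ^+ 2) `^ (c * ln n%:R); last by rewrite powRr0 in h.
  apply: ler_powR => //; apply: mulr_ege1; first by rewrite ler1n.
  exact: exprn_ege1.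
have W0 : 0 <= W := le_trans ler01 W1.
have zeta_le : inversion_error u mu c X <= u * W * (2 * B).
  rewrite /inversion_error; apply: ler_pM; [|exact: opnorm_ge0| |exact: hV].
    exact: mulr_ge0 (mulr_ge0 (le_trans ler01 mu1) (ltW u0)) (powR_ge0 _ _).
  rewrite /W [mu n * u]mulrC -mulrA; apply: ler_wpM2l; first exact: ltW.
  apply: ler_wpM2l; first exact: le_trans ler01 mu1.
  by apply: ge0_ler_powR => //; rewrite nnegrE // mulr_ge0 // sqr_ge0.
set z := inversion_error _ _ _ _ in zeta_le *.
have BW0 : 0 <= u * W * B := mulr_ge0 (mulr_ge0 (ltW u0) W0) B0.
have bound_n (y : R) : 0 <= y -> y <= n%:R * y by move=> y0; exact: ler_peMl.
have h1 : u * (opnorm X + (opnorm (invmx X) + z)) <= u * (4 * B) + u * (u * W * (2 * B)).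
  rewrite -mulrDr ler_pM2l //; clear cond_le cond0; abstract_norms; lra.
have h2 : u * (4 * B) <= 4 * (u * W * B).
  have -> : 4 * (u * W * B) = u * (4 * B) * W by ring.
  exact: ler_peMr (mulr_ge0 (ltW u0) (mulr_ge0 (ler0n _ 4) B0)) W1.
have h3 : u * (u * W * (2 * B)) <= 1 / 10 * (u * W * (2 * B)).
  by apply: ler_wpM2r => //; exact: mulr_ge0 (mulr_ge0 (ltW u0) W0) (mulr_ge0 (ler0n _ 2) B0).
have -> : 10 * u * n%:R * B * W = n%:R * (10 * (u * W * B)) by ring.
have h4 : u * W * B <= n%:R * (u * W * B) by exact: bound_n.
clear hX hV cond_le cond0.
have h5 : n%:R * (2 * (u * (opnorm X + (opnorm (invmx X) + z)))) <= n%:R * (9 * (u * W * B)).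
  by rewrite ler_wpM2l //; abstract_norms; lra.
by rewrite -(mulrA 2 u); abstract_norms; lra.
Qed.

(** The linear phase needs 16 (5 K)^5 <= 2 ^ k0. Since 5 K <= 2 ^ (m1 + 3), this
    holds for k0 = 19 + 5 m1. The m2 doublings which follow bring the error below
    a multiple of beta, and two more of them leave 32 beta^4 <= beta / 2. *)
Lemma iterate_accuracy_counts n (A S : 'M[C]_n) (K beta : R) m1 m2 :
  1 <= K -> axis_free A -> rot_bounded (5 * K) A ->
  S *m S = 1%:M -> A *m S = S *m A -> right_half (A *m S) -> 0 < beta < 1 / 12 ->
  4 / 5 * K <= 2 ^+ m1 -> 1 / (2 * beta) <= 2 ^+ (2 ^ m2) ->
  opnorm (iterate A (21 + 5 * m1 + m2) - S) <= beta / 2.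
Proof.
move=> K1 fA bA SS AS rAS /andP[b0 b12] hK hb.
have -> : (21 + 5 * m1 + m2 = (19 + 5 * m1) + (2 + m2))%N by lia.
have B1 : 1 <= 5 * K by lra.
have hlip : 2 * (5 * K * lip (5 * K)) <= 2 ^+ (19 + 5 * m1).
  have B8 : 5 * K <= 2 ^+ m1 * 2 ^+ 3 by lra.
  set B := 5 * K in B1 B8 *.
  have hB5 : B ^+ 5 <= (2 ^+ m1 * 2 ^+ 3) ^+ 5 by apply: lerXn2r; rewrite ?nnegrE; lra.
  have -> : 2 ^+ (19 + 5 * m1) = 2 ^+ 4 * (2 ^+ m1 * 2 ^+ 3) ^+ 5 :> R.
    by rewrite -exprD -exprM -exprD; congr (_ ^+ _); lia.
  apply: (@le_trans _ _ (2 ^+ 4 * B ^+ 5)); last by rewrite ler_pM2l // exprn_gt0.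
  have B0 : 0 <= B by lra.
  have hB1 : 1 + B ^+ 2 <= 2 * B ^+ 2.
    have h : 1 * 1 <= B * B by apply: ler_pM.
    by rewrite expr2; lra.
  have hB2 : (1 + B) ^+ 2 <= (2 * B) ^+ 2 by apply: lerXn2r; rewrite ?nnegrE; lra.
  have hl : lip B <= 2 * B ^+ 2 * (2 * B) ^+ 2.
    by apply: ler_pM => //; [rewrite addr_ge0 // sqr_ge0|apply: sqr_ge0].
  have -> : 2 ^+ 4 * B ^+ 5 = 2 * (B * (2 * B ^+ 2 * (2 * B) ^+ 2)) by ring.
  by rewrite ler_pM2l // ler_wpM2l.
apply: le_trans (iterate_accuracy B1 fA bA SS AS rAS (2 + m2) hlip) _.
rewrite expnD mulnC exprM.
have e0 : 0 <= (1 / 2) ^+ (2 ^ m2) :> R by apply: exprn_ge0; lra.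
have hx : (1 / 2) ^+ (2 ^ m2) <= 2 * beta.
  rewrite expr_div_n expr1n div1r -[2 * beta]invrK lef_pV2 ?posrE ?invr_gt0 ?exprn_gt0 ?mulr_gt0 //.
  by rewrite -div1r.
have h4 : ((1 / 2) ^+ (2 ^ m2)) ^+ (2 ^ 2) <= (2 * beta) ^+ 4.
  by apply: lerXn2r => //; rewrite nnegrE // mulr_ge0 // ltW.
have b3 : beta ^+ 3 <= (1 / 12) ^+ 3 by apply: lerXn2r; rewrite ?nnegrE; lra.
have e4 : (2 * beta) ^+ 4 = 16 * beta ^+ 3 * beta by ring.
rewrite e4 in h4.
have h5 : 16 * beta ^+ 3 * beta <= 1 / 4 * beta.
  rewrite ler_pM2r //; move: b3; have -> : (1 / 12) ^+ 3 = 1 / 12 * (1 / 12) * (1 / 12) :> R by ring.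
  lra.
by move: h4; set y := _ ^+ (2 ^ 2); lra.
Qed.

Lemma run_iterations (u : R) (d : nat -> C) INV (mu : nat -> R) (c : R) (T : nat -> nat)
    n (A : 'M[C]_n) (B eta : R) (q : nat) (s : state R) (d0 : C) :
  0 < u -> u <= 1 / 10 -> adversary u d ->
  stable_inversion INV mu c T -> (1 < n)%N -> 1 <= mu n -> 0 <= c * ln n%:R ->
  1 <= B -> axis_free A -> rot_bounded B A -> q.+1%:R * drift B eta <= B ->
  10 * u * n%:R * B * (mu n * (4 * B ^+ 2) `^ (c * ln n%:R)) <= eta -> 0 <= eta ->
  nvar s 0%N = n -> nvar s 1%N = q -> nvar s 2%N = 0%N ->
  fmem s 4%N 0%N 0%N = 2 * (1 + d0) -> normc d0 <= u ->
  tracks A B eta 0 (mx_of_arr n (fmem s 0%N)) ->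
  run u d (While (NLt (NVar 2) (NVar 1)) (Seq (newton_step INV) (incr 2))) s
    (fun s' => tracks A B eta q (mx_of_arr n (fmem s' 0%N)) /\
       (ops s' <= ops s + q * (T n + 2 * (n * n)))%N).
Proof.
move=> u0 u10 adv stab n1 mu1 c0 B1 fA bA small err eta0 sn sq sk two hd0 tr.
pose I k s' := [/\ nvar s' 0%N = n /\ nvar s' 1%N = q, nvar s' 2%N = k /\ (k <= q)%N,
  fmem s' 4%N 0%N 0%N = 2 * (1 + d0),
  tracks A B eta k (mx_of_arr n (fmem s' 0%N)) &
  (ops s' <= ops s + k * (T n + 2 * (n * n)))%N].
apply: (@run_while _ _ _ _ _ I q 0).
- move=> k s1 [[e0 e1] [e2 k_q] two1 tr1 op1] /=; rewrite e1 e2 => kq; split=> //.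
  set Y := mx_of_arr n (fmem s1 0%N) in tr1.
  have bY := tracks_rot_bounded B1 fA bA small eta0 k_q tr1.
  have [fY _] := tr1.
  have nY : opnorm Y <= 2 * B by have := bY 0; rewrite rotm0.
  have nVY : opnorm (invmx Y) <= 2 * B by have := bY (pi / 2); rewrite (rot_pihalf fY).
  apply: run_seq; apply: run_weaken.
    exact: (@run_newton_step R u d u0 u10 adv INV mu c T s1 n Y d0 stab n1 e0 erefl
      (axis_free_unitmx fY) two1 hd0).
  move=> s2 [[c0' c1' c2'] a4 op2 acc]; apply: run_nset; split=> /=.
  + by rewrite /upd /= c0' c1'.
  + by rewrite /upd /= c2' e2 addn1.
  + by rewrite a4.
  + apply: (tracks_step B1 fA bA small eta0 kq tr1).
    apply: le_trans acc _; apply: le_trans err.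
    exact: step_error_le.
  + apply: leq_trans op2 _; move: op1; set t := (T n + 2 * (n * n))%N => op1.
    by rewrite mulSn addnCA [X in (_ <= X)%N]addnC leq_add2r.
- move=> k s1 [[e0 e1] [e2 k_q] two1 tr1 op1] /=; rewrite e1 e2 -leqNgt => qk.
  have Ek : k = q by apply/eqP; rewrite eqn_leq k_q.
  by rewrite Ek in tr1 op1; split.
- by split; rewrite ?mul0n ?addn0.
Qed.

End Assembly.

Lemma scalar_arrE (R : realType) (x : R[i]) : scalar_arr x 0%N 0%N = x.
Proof. by rewrite /scalar_arr /arr_of_mx -[0%N]/(val (ord0 : 'I_1)) !valK mxE. Qed.

Section Counting.
Variable R : realType.
Local Notation C := R[i].

Lemma iter_addnn m : iter m (fun p => p + p)%N 1%N = (2 ^ m)%N.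
Proof. by elim: m => //= m ->; rewrite expnS mul2n addnn. Qed.

Lemma iter_mulnn m : iter m (fun p => p * p)%N 2%N = (2 ^ (2 ^ m))%N.
Proof. by elim: m => //= m ->; rewrite -expnD addnn -mul2n expnS. Qed.

(** The prologue of the program. The lower bounds on m1 and m2 serve the accuracy,
    the upper bounds serve the operation count. *)
Lemma run_counting (u : R) (d : nat -> C) (n : nat) (a0 : arr R) (K beta : R) (K' beta' : C) (rest : cmd) Q :
  0 < u -> u <= 1 / 10 -> adversary u d ->
  1 <= K -> 0 < beta < 1 / 12 -> stored u K%:C K' -> stored u beta%:C beta' ->
  (forall m1 m2 s (d0 : C),
    m1%:R <= 2 * ln (Num.max K 2) + 3 -> m2%:R <= 2 * ln (ln (1 / beta)) + 4 ->
    4 / 5 * K <= 2 ^+ m1 -> 1 / (2 * beta) <= 2 ^+ (2 ^ m2) ->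
    nvar s 0%N = n -> nvar s 1%N = (21 + 5 * m1 + m2)%N -> nvar s 2%N = 0%N ->
    fmem s 0%N = a0 -> fmem s 4%N 0%N 0%N = 2 * (1 + d0) -> normc d0 <= u ->
    (ops s <= 2 * m1 + 2 * m2 + 7)%N -> run u d rest s Q) ->
  run u d (
    Seq (NSet 1 (NCst 21))
    (Seq (search 1 1 (NAdd (NVar 5) (NVar 5)) 5)
    (Seq (FSet (cell 6) (FCst (NCst 1) (NCst 0)))
    (Seq (FSet (cell 2) (FBin FDiv (cell 6) (cell 2)))
    (Seq (search 2 2 (NMul (NVar 5) (NVar 5)) 1)
    (Seq (FSet (cell 4) (FCst (NCst 2) (NCst 0)))
    (Seq (NSet 2 (NCst 0)) rest)))))))
    (init n [:: a0; scalar_arr K'; scalar_arr beta'] 0) Q.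
Proof.
move=> u0 u10 adv K1 hb [e1 he1 eK'] [e2 he2 eb'] post.
have /andP[b0 b12] := hb.
have K0 : 0 <= K by lra.
have lK0 : 0 <= ln (Num.max K 2).
  have := @ln_ge_half R (Num.max K 2); rewrite le_max lexx orbT => /(_ isT); lra.
have lb1 := ln_inv_ge1 hb.
have ll0 : 0 <= ln (ln (1 / beta)) by exact: ln_ge0.
have [m10 m10_le m10_ge] := pow2_reaches lK0.
have [m20 m20_le m20_ge] := pow2_reaches ll0.
have K2 : K <= Num.max K 2 by rewrite le_max lexx.
have K20 : 0 < Num.max K 2 by rewrite lt_max ltr0n orbT.
rewrite lnK ?posrE // in m10_ge.
rewrite lnK ?posrE ?(lt_le_trans ltr01 lb1) // in m20_ge.
have /andP[K'lo K'hi] : K * (1 - u) <= Re K' <= K * (1 + u).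
  have -> : K' = K%:C * (1 + e1) by rewrite eK' mulrC.
  by apply: Re_scaled => //; rewrite addrC addKr.
apply: run_seq; apply: run_nset; apply: run_seq.
apply: run_weaken.
  apply: (@run_search R u d u0 u10 adv 1 1 (NAdd (NVar 5) (NVar 5)) 5 (fun p => p + p)%N _ m10) => //.
  rewrite /= scalar_arrE iter_addnn natrX; apply: le_trans K'hi _.
  have h : 2 ^+ m10 * (9 / 10) <= 2 ^+ m10 * (1 - u) by rewrite ler_wpM2l ?exprn_ge0 //; lra.
  have h2 : K * (1 + u) <= K * (11 / 10) by rewrite ler_wpM2l //; lra.
  lra.
rewrite /= scalar_arrE => s1 [m1 [m1_le ex1 [c10 c11] fr1 op1]].
rewrite iter_addnn natrX in ex1.
apply: run_seq; apply: run_fset; first by [].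
have ne : 1 + e2 != 0 by case: (rounding_error u10 he2 he2 he2).
have bne : beta' != 0.
  by rewrite eb' mulf_neq0 //; apply/eqP => -[] /eqP; rewrite gt_eqF.
apply: run_seq; apply: run_fset.
  rewrite /= /upd /= fr1 //= scalar_arrE (negbTE bne); reflexivity.
set s2 := State _ _ _; pose x := fmem s2 2%N 0%N 0%N.
have [b1' b2'] : 3 / 5 / beta <= Re x /\ Re x <= 7 / 5 / beta.
  have -> : x = (1 / beta)%:C * ((1 + d (ops s1)) * (1 + d (ops s1).+1) / (1 + e2)).
    rewrite /x /s2 /= /upd /= eb'.
    have -> : (1%:R +i* 0%:R) = 1 :> C by [].
    have -> : (1 / beta)%:C = (beta%:C)^-1 by rewrite div1r fmorphV.
    have bC : beta%:C != 0 :> C by apply/eqP => -[] /eqP; rewrite gt_eqF.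
    by field; rewrite bC ne.
  have [_ h] := rounding_error u10 (adv (ops s1)) (adv (ops s1).+1) he2.
  have ib : 0 <= 1 / beta by rewrite divr_ge0 // ltW.
  have /andP[h1 h2] := Re_scaled ib h.
  split.
    have -> : 3 / 5 / beta = 1 / beta * (3 / 5) by rewrite div1r mulrC.
    by apply: le_trans h1; rewrite ler_wpM2l //; lra.
  have -> : 7 / 5 / beta = 1 / beta * (7 / 5) by rewrite div1r mulrC.
  by apply: le_trans h2 _; rewrite ler_wpM2l //; lra.
have x2E : fmem s2 2%N 0%N 0%N = x by [].
clearbody x.
apply: run_seq; apply: run_weaken.
  apply: (@run_search R u d u0 u10 adv 2 2 (NMul (NVar 5) (NVar 5)) 1 (fun p => p * p)%N s2 m20.+1) => //.
  rewrite x2E iter_mulnn natrX; apply: le_trans b2' _.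
  have big : 2 / beta <= 2 ^+ (2 ^ m20.+1).
    apply: (@le_trans _ _ (expR (1 / 2) ^+ (2 ^ m20.+1))); last first.
      by apply: lerXn2r (expR_half_le2 R); rewrite nnegrE ?expR_ge0.
    rewrite -expRM_natr natrX exprS; apply: (@le_trans _ _ (expR (1 + ln (1 / beta)))).
      have -> : 2 / beta = 2 * (1 / beta) by rewrite div1r.
      rewrite expRD lnK ?posrE ?divr_gt0 // ler_pM2r ?divr_gt0 //.
      by apply: le_trans (expR_ge1Dx _); lra.
    by rewrite ler_expR; lra.
  have h : 2 ^+ (2 ^ m20.+1) * (9 / 10) <= 2 ^+ (2 ^ m20.+1) * (1 - u) :> R.
    by rewrite ler_wpM2l ?exprn_ge0 //; lra.
  apply: le_trans h; have ib : 0 < 1 / beta by rewrite divr_gt0.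
  move: big ib; rewrite div1r; lra.
move=> s3 [m2 [m2_le ex2 [c20 c21] fr2 op2]].
rewrite iter_mulnn natrX x2E in ex2.
apply: run_seq; apply: run_fset; first by [].
apply: run_seq; apply: run_nset.
apply: (post m1 m2 _ (d (ops s3))).
- by apply: le_trans m10_le; rewrite ler_nat.
- apply: (@le_trans _ _ (m20.+1%:R)); first by rewrite ler_nat.
  by rewrite -natr1; lra.
- have h : 2 ^+ m1 * (1 + u) <= 2 ^+ m1 * (11 / 10) by rewrite ler_wpM2l ?exprn_ge0 //; lra.
  have h2 : K * (9 / 10) <= K * (1 - u) by rewrite ler_wpM2l //; lra.
  lra.
- have h : 2 ^+ (2 ^ m2) * (1 + u) <= 2 ^+ (2 ^ m2) * (11 / 10) by rewrite ler_wpM2l ?exprn_ge0 //; lra.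
  have -> : 1 / (2 * beta) = 1 / 2 / beta by rewrite invfM mulrA.
  have ib : 0 <= beta^-1 by rewrite invr_ge0 ltW.
  by move: b1' ib; lra.
- by rewrite /= /upd /= c20 /s2 /= c10.
- by rewrite /= /upd /= c21 /s2 /= c11 /= /upd /= mul1n.
- by [].
- by rewrite /= /upd /= fr2 // /s2 /= /upd /= fr1.
- have E2 : 2%:R +i* 0%:R = 2 :> C by apply/eqP; rewrite eq_complex /= addr0 !eqxx.
  by rewrite /= /upd /= E2.
- exact: adv.
- by rewrite /= op2 /s2 /= op1; clear; lia.
Qed.

End Counting.

Theorem theorem1p5 (R : realType)
    (INV : cmd) (mu : nat -> R) (c : R) (T : nat -> nat)
    (INV_stable : stable_inversion INV mu c T)
    (mu_ge1 : forall n : nat, (1 < n)%N -> 1 <= mu n)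
    (mu_poly : exists (a : R) (k : nat),
       forall n : nat, (1 < n)%N -> mu n <= a * n%:R ^+ k)
    (c_log_ge1 : forall n : nat, (1 < n)%N -> 1 <= c * ln n%:R) :
  exists (SGN : cmd) (Cops Cbits : R),
  forall (n : nat) (A : 'M[R[i]]_n) (K beta : R),
  (1 < n)%N -> opnorm A <= 1 -> (kappa_sign A <= K%:E)%E ->
  0 < beta < 1 / 12 ->
  forall u : R, 0 < u ->
  Cbits * (ln n%:R * ln (Num.max K 2) ^+ 3
           * (ln (Num.max K 2) + ln (1 / beta))) <= lg (1 / u) ->
  forall (A' : 'M[R[i]]_n) (K' beta' : R[i]) (d : nat -> R[i]),
  stored_mx u A A' -> stored u K%:C K' -> stored u beta%:C beta' ->
  adversary u d ->
  exists s : state R,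
  [/\ exec u d SGN
        (init n [:: arr_of_mx A'; scalar_arr K'; scalar_arr beta'] 0) s,
      (ops s)%:R <= Cops * ((ln (Num.max K 2) + ln (ln (1 / beta)))
                            * (T n)%:R) &
      forall S : 'M[R[i]]_n, is_sgn A S ->
        opnorm (mx_of_arr n (fmem s 0%N) - S) <= beta].
Proof.
case: mu_poly => a [k mu_le].
have [Cbits small] := small_precision mu_le mu_ge1 c_log_ge1.
exists (sgn_program INV), 1600, Cbits.
move=> n A K beta n1 A1 kK hb u u0 bits A' K' beta' d stA stK stb adv.
have [K1 fA bA] := initial_rot_bounded (ltnW n1) A1 kK.
have /andP[b0 b12] := hb.
have {}small Q := small n K beta u Q n1 K1 hb u0 bits.
set lK := ln (Num.max K 2) in bits small *; set ll := ln (ln (1 / beta)) in small *.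
have lKh : 1 / 2 <= lK by apply: ln_ge_half; rewrite le_max lexx orbT.
have ll0 : 0 <= ll by apply: ln_ge0; apply: ln_inv_ge1.
have mu1 := mu_ge1 n n1.
have c0 : 0 <= c * ln n%:R := le_trans ler01 (c_log_ge1 n n1).
set B := 5 * K in bA small.
have B1 : 1 <= B by rewrite /B; lra.
have nn : 1 <= n%:R :> R by rewrite ler1n ltnW.
set W := mu n * _ in small.
have W1 : 1 <= W.
  rewrite /W; apply: mulr_ege1 => //.
  have h : (4 * B ^+ 2) `^ 0 <= (4 * B ^+ 2) `^ (c * ln n%:R); last by rewrite powRr0 in h.
  apply: ler_powR => //; apply: mulr_ege1; first by rewrite ler1n.
  exact: exprn_ege1.
(* eta bounds the error of a step and the storage error of the input *)
pose eta := 10 * u * n%:R * B * W.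
have B0 : 0 <= B := le_trans ler01 B1.
have W0 : 0 <= W := le_trans ler01 W1.
have n0 : 0 <= n%:R :> R := ler0n _ n.
have u_eta : n%:R * u <= eta.
  have -> : eta = (n%:R * u) * (10 * (B * W)) by rewrite /eta; ring.
  apply: ler_peMr; first exact: mulr_ge0 n0 (ltW u0).
  have h : 1 <= B * W by apply: mulr_ege1.
  lra.
have eta0 : 0 <= eta := le_trans (mulr_ge0 n0 (ltW u0)) u_eta.
have B3 : 1 <= B ^+ 3 by apply: exprn_ege1.
(* the smallness condition with Q = 1 already bounds u *)
have u10 : u <= 1 / 10.
  have := small 1; rewrite mul1r => /(_ _).
  have -> : 180 * u * n%:R * B ^+ 3 * W = u * 180 * (n%:R * (B ^+ 3 * W)) by ring.
  have h : u * 180 <= u * 180 * (n%:R * (B ^+ 3 * W)).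
    apply: ler_peMr; first by apply: mulr_ge0 => //; exact: ltW.
    by do 2 (apply: mulr_ege1 => //).
  move=> h2; have {}h2 := le_trans h (h2 _); rewrite ler01 /= in h2.
  have : 1 <= 100 * (lK + ll) by lra.
  by move/h2; lra.
have drift_le (q : nat) : q.+1%:R <= 100 * (lK + ll) -> q.+1%:R * drift B eta <= beta / 2.
  move=> hq; apply: le_trans (small q.+1%:R _); last by rewrite ler0n.
  rewrite ler_wpM2l // /drift.
  have h : (1 + 2 * B) ^+ 2 <= (3 * B) ^+ 2 by apply: lerXn2r; rewrite ?nnegrE; lra.
  have -> : 180 * u * n%:R * B ^+ 3 * W = 2 * (3 * B) ^+ 2 * eta by rewrite /eta; ring.
  by rewrite ler_wpM2r // ler_wpM2l.
suff [s e [acc ops_le]] : run u d (sgn_program INV)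
    (init n [:: arr_of_mx A'; scalar_arr K'; scalar_arr beta'] 0)
    (fun s => (forall S, is_sgn A S -> opnorm (mx_of_arr n (fmem s 0%N) - S) <= beta) /\
       (ops s)%:R <= 1600 * ((lK + ll) * (T n)%:R)).
  by exists s; split.
apply: (run_counting (n := n) u0 u10 adv K1 hb stK stb).
move=> m1 m2 s d0 m1_le m2_le m1_ge m2_ge sn sq sk s0 two hd0 ops0.
set q := (21 + 5 * m1 + m2)%N in sq.
have qE : q%:R = 21 + 5 * m1%:R + m2%:R :> R by rewrite /q natrD (natrD _ 21 (5 * m1)) natrM.
rewrite -/lK -/ll in m1_le m2_le.
have q_le : q.+1%:R <= 100 * (lK + ll) by rewrite -natr1 qE; lra.
have hd := drift_le q q_le.
have tr0 : tracks A B eta 0 (mx_of_arr n (fmem s 0%N)).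
  apply: (tracks0 B1 fA bA (q := q)) => //; first by lra.
  rewrite s0 arr_of_mxK; apply: le_trans u_eta.
  apply: opnorm_entries; first exact: ltW.
  move=> i j; rewrite !mxE; have [D hD ->] := stA i j.
  have -> : (1 + D) * A i j - A i j = D * A i j by ring.
  rewrite normcM -[u]mulr1; apply: ler_pM => //; try exact: normc_ge0.
  exact: le_trans (normc_entry A i j) A1.
apply: run_weaken.
  apply: (run_iterations (A := A) (B := B) (eta := eta) (q := q) (d0 := d0) u0 u10 adv INV_stable n1) => //.
  by lra.
move=> s' [tr ops1]; split.
  move=> S /is_sgnP [SS AS rAS].
  apply: le_trans (opnorm_triangle (iterate A q) _ _) _.
  have h1 := le_trans (tracks_near tr) hd.
  have h2 := iterate_accuracy_counts K1 fA bA SS AS rAS hb m1_ge m2_ge.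
  by rewrite -/q in h2; clear -h1 h2; abstract_norms; lra.
have Tn := stable_inversion_ops_ge INV_stable n1.
have T1 : (1 <= T n)%N by move: Tn n1; clear; nia.
have ops2 : (ops s' <= (87 * m1 + 19 * m2 + 364) * T n)%N.
  apply: leq_trans ops1 _; rewrite /q; move: Tn T1 ops0; clear.
  move: (T n) (ops s) => t o; rewrite -mulnn => h1 h2 h3.
  have h4 : (2 * (n * n) <= 16 * t)%N by lia.
  nia.
have T1R : 1 <= (T n)%:R :> R by rewrite ler1n.
have : (ops s')%:R <= (87 * m1%:R + 19 * m2%:R + 364) * (T n)%:R :> R.
  have -> : (87 * m1%:R + 19 * m2%:R + 364) * (T n)%:R =
      ((87 * m1 + 19 * m2 + 364) * T n)%:R :> R by rewrite natrM natrD (natrD _ (87 * m1) (19 * m2)) !natrM.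
  by rewrite ler_nat.
move=> h; apply: le_trans h _; rewrite mulrA ler_wpM2r //.
by move: lKh ll0 m1_le m2_le; clear; lra.
Qed.
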